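(* Let $\lambda_1,\dots,\lambda_n$ be real numbers with $$\lambda_1 > \lambda_2> \ldots > \lambda_l=\lambda_{l+1}= \ldots = \lambda_{l+s}>\lambda_{l+s+1}> \ldots > \lambda_n$$ for some $l\ge 1$ and $s\geq 0$, not all equal, and let $M=\mathcal{O}_{\lambda}$ be the coadjoint orbit of $U(n)$ through the point $\mathrm{diag}(\lambda_1,\ldots,\lambda_n)\in\mathfrak{u}(n)^*$, with its standard symplectic form. Then the Gromov width of $M$ is at least $$\min\{\lambda_i-\lambda_j \mid \lambda_i>\lambda_j\}.$$
   Context: The dual $\mathfrak{u}(n)^*$ and the Lie algebra $\mathfrak{u}(n)$ are both identified with the space of $n\times n$ Hermitian matrices, with pairing $(A,B)=\mathrm{trace}(AB)$. The coadjoint action is conjugation, so $\mathcal{O}_\lambda$ is the set of all $n\times n$ Hermitian matrices with eigenvalues $\lambda_1,\dots,\lambda_n$ (with multiplicity). Symplectic form: $\mathcal{O}_\lambda$ carries the Kostant–Kirillov–Souriau form $\omega$ for which the $U(n)$ action by conjugation is Hamiltonian with moment map the inclusion $\mathcal{O}_\lambda\hookrightarrow\mathfrak{u}(n)^*$. Conventions: a moment map $\Phi$ satisfies $\iota(\xi_M)\omega=-d\langle\Phi,\xi\rangle$; $\mathrm{Lie}(S^1)$ is identified with $\mathbb{R}$ so that the exponential map is $t\mapsto e^{2\pi i t}$; correspondingly a Hermitian matrix $X$ generates the one-parameter group $t\mapsto e^{2\pi i tX}$. Explicitly, $\omega_A(2\pi i[X,A],Y)=-\mathrm{trace}(XY)$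 for $Y\in T_A\mathcal{O}_\lambda$. Gromov width: for $a>0$ let $B^{2N}_a=\{z\in\mathbb{C}^N \mid \pi\sum_{i=1}^N|z_i|^2<a\}$ with the standard symplectic form $\sum dx_j\wedge dy_j$. The Gromov width of a $2N$-dimensional symplectic manifold $(M,\omega)$ is the supremum of the set of $a$ such that $B^{2N}_a$ can be symplectically embedded in $(M,\omega)$. *)

(* Defs.v *)
From mathcomp Require Import all_boot all_order all_algebra.
From mathcomp Require Import spectral sesquilinear complex.
From mathcomp Require Import all_classical all_reals all_analysis.

Set Implicit Arguments.
Unset Strict Implicit.
Unset Printing Implicit Defensive.

Import Order.TTheory GRing.Theory Num.Theory.
Import numFieldNormedType.Exports.

Local Open Scope ring_scope.
Local Open Scope classical_set_scope.
Local Open Scope complex_scope.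
Local Open Scope sesquilinear_scope.

(* C^k maps between (finite-dimensional) normed spaces on an open set U.      *)
Fixpoint Ck_on (R : realType) (V W : normedModType R) (k : nat) (U : set V)
    (f : V -> W) : Prop :=
  match k with
  | 0 => forall x, U x -> {for x, continuous f}
  | k'.+1 => (forall x, U x -> differentiable f x) /\
             forall v, Ck_on k' U (fun x => 'd f x v)
  end.

Definition smooth_on (R : realType) (V W : normedModType R) (U : set V)
    (f : V -> W) : Prop :=
  forall k, Ck_on k U f.

(* C^N is encoded as pairs (x, y) of real vectors, z_j = x_j + i y_j.         *)
Definition ball_sympl (R : realType) (N : nat) (a : R) :
    set ('rV[R]_N * 'rV[R]_N) :=
  [set z : 'rV[R]_N * 'rV[R]_N |
    pi * \sum_(j < N) (z.1 0 j ^+ 2 + z.2 0 j ^+ 2) < a].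

(* sum_j dx_j /\ dy_j *)
Definition std_form (R : realType) (N : nat) (v w : 'rV[R]_N * 'rV[R]_N) : R :=
  \sum_(j < N) (v.1 0 j * w.2 0 j - v.2 0 j * w.1 0 j).

(* The type of complex matrices is not declared as a real normed space in the *)
(* libraries; calculus is done in these global real linear coordinates.       *)
Definition reim (R : realType) (n : nat) (A : 'M[R[i]]_n) :
    'M[R]_n * 'M[R]_n :=
  (map_mx (@complex.Re R) A, map_mx (@complex.Im R) A).

Definition of_reim (R : realType) (n : nat) (P : 'M[R]_n * 'M[R]_n) :
    'M[R[i]]_n :=
  \matrix_(i, j) (P.1 i j +i* P.2 i j).

Definition dmx (R : realType) (V : normedModType R) (n : nat)
    (f : V -> 'M[R[i]]_n) (z v : V) : 'M[R[i]]_n :=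
  of_reim ('d (reim (n:=n) \o f) z v).

(* Symplectic embeddings of the ball into an embedded submanifold M of the    *)
(* space of matrices, om A being a 2-form on the tangent space of M at A.     *)
(* The topological embedding condition is the continuity of the inverse.      *)
(* That f is an immersion follows from the last clause, since std_form is     *)
(* nondegenerate.                                                             *)
Definition symplectic_embedding (R : realType) (N n : nat) (a : R)
    (M : set 'M[R[i]]_n) (om : 'M[R[i]]_n -> 'M[R[i]]_n -> 'M[R[i]]_n -> R)
    (f : 'rV[R]_N * 'rV[R]_N -> 'M[R[i]]_n) : Prop :=
  let B := @ball_sympl R N a in
  [/\ smooth_on B (reim (n:=n) \o f),
      forall z, B z -> M (f z),
      set_inj B f,
      exists2 g : 'M[R]_n * 'M[R]_n -> 'rV[R]_N * 'rV[R]_N,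
        (forall z, B z -> g (reim (f z)) = z) &
        {within (reim (n:=n) \o f) @` B, continuous g} &
      forall z v w, B z -> om (f z) (dmx f z v) (dmx f z w) = std_form v w].

(* N is half the dimension of M. *)
Definition gromov_width (R : realType) (N n : nat) (M : set 'M[R[i]]_n)
    (om : 'M[R[i]]_n -> 'M[R[i]]_n -> 'M[R[i]]_n -> R) : \bar R :=
  ereal_sup [set a%:E | a in
    [set a : R | 0 < a /\ exists f : 'rV[R]_N * 'rV[R]_N -> 'M[R[i]]_n,
                            symplectic_embedding a M om f]].

Definition coadjoint_orbit (R : realType) (n : nat) (lam : 'I_n -> R) :
    set 'M[R[i]]_n :=
  [set A | exists2 U : 'M[R[i]]_n, U \is unitarymx &
           A = U *m diag_mx (\row_i (lam i)%:C) *m U^t*].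

(* 2 pi i [X, A], the velocity at A of t |-> e^(2 pi i t X) A e^(-2 pi i t X) *)
Definition adfield (R : realType) (n : nat) (X A : 'M[R[i]]_n) : 'M[R[i]]_n :=
  (0 +i* (2 * pi)) *: (X *m A - A *m X).

Definition orbit_tangent (R : realType) (n : nat) (A : 'M[R[i]]_n) :
    set 'M[R[i]]_n :=
  [set adfield X A | X in [set X : 'M[R[i]]_n | X \is hermsymmx]].

(* Kostant-Kirillov-Souriau form: omega_A(2 pi i [X, A], Y) = - tr (X Y) for  *)
(* Y tangent to the orbit at A. By kksE below the value does not depend on    *)
(* the X chosen by xget.                                                      *)
Definition kks (R : realType) (n : nat) (A u v : 'M[R[i]]_n) : R :=
  - complex.Re (\tr (xget 0 [set X : 'M[R[i]]_n | X \is hermsymmx /\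
                                     adfield X A = u] *m v)).

Lemma kksE (R : realType) (n : nat) (A X Y : 'M[R[i]]_n) :
  X \is hermsymmx -> orbit_tangent A Y ->
  kks A (adfield X A) Y = - complex.Re (\tr (X *m Y)).
Proof.
move=> hX [Z hZ <-]; rewrite /kks.
case: xgetP => [X' _ [hX' e]|/(_ X)/=]; last by case.
congr (- complex.Re _); apply/eqP; rewrite -subr_eq0 -linearB /= -mulmxBl.
have c0 : (0 +i* (2 * pi) : R[i]) != 0.
  by rewrite eq_complex /= negb_and orbC mulf_neq0 // gt_eqF // pi_gt0.
have {e} : X' *m A - A *m X' = X *m A - A *m X by apply: (scalerI c0).
set W := X' - X => e.
have eW : W *m A = A *m W.
  rewrite mulmxBl mulmxBr; move/eqP: e; rewrite subr_eq => /eqP ->.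
  by rewrite addrAC [X in X + _]addrAC subrr sub0r addrC.
rewrite /adfield -scalemxAr mxtraceZ mulmxBr mulf_eq0; apply/orP; right.
by rewrite linearB /= !mulmxA eW -[A *m W *m Z]mulmxA [\tr (A *m _)]mxtrace_mulC -!mulmxA subrr.
Qed.

(* Half the dimension of the orbit: one complex coordinate for each pair of   *)
(* distinct eigenvalues, see orbit_tangent_dim.                               *)
Definition orbit_hdim (R : realType) (n : nat) (lam : 'I_n -> R) : nat :=
  #|[pred p : 'I_n * 'I_n | lam p.2 < lam p.1]|.

Lemma adfield_diag (R : realType) (n : nat) (lam : 'I_n -> R)
    (X : 'M[R[i]]_n) (i j : 'I_n) :
  adfield X (diag_mx (\row_i (lam i)%:C)) i j =
  (0 +i* (2 * pi)) * (lam j - lam i)%:C * X i j.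
Proof.
rewrite /adfield mul_mx_diag mul_diag_mx !mxE rmorphB /= -mulrA; congr (_ * _).
by rewrite mulrBl [X i j * _]mulrC.
Qed.

Lemma orbit_tangent_diag_dim (R : realType) (n : nat) (lam : 'I_n -> R) :
  let D : 'M[R[i]]_n := diag_mx (\row_i (lam i)%:C) in
  let m := orbit_hdim lam in
  exists P : 'M[R[i]]_n -> 'rV[R]_(m + m),
    (forall (a : R) (A B : 'M[R[i]]_n), P (a%:C *: A + B) = a *: P A + P B) /\
    set_bij (orbit_tangent D) setT P.
Proof.
move=> D m; set c : R[i] := 0 +i* (2 * pi).
have c0 : c != 0.
  by rewrite eq_complex /= negb_and orbC mulf_neq0 // gt_eqF // pi_gt0.
have f0 x y : lam x < lam y -> c * (lam x - lam y)%:C != 0.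
  by move=> lt; rewrite mulf_neq0 // (fmorph_eq0 (real_complex R)) subr_eq0 lt_eqF.
pose S := [pred p : 'I_n * 'I_n | lam p.2 < lam p.1].
pose ev : 'I_m -> 'I_n * 'I_n := fun k => enum_val (k : 'I_#|S|).
have evS k : lam (ev k).2 < lam (ev k).1 by have := enum_valP (k : 'I_#|S|).
have evI : injective ev by exact: enum_val_inj.
pose P (M : 'M[R[i]]_n) : 'rV[R]_(m + m) :=
  row_mx (\row_k complex.Re (M (ev k).1 (ev k).2))
         (\row_k complex.Im (M (ev k).1 (ev k).2)).
exists P; split.
  move=> a A B; rewrite /P scale_row_mx add_row_mx.
  congr row_mx; apply/rowP => k; rewrite !mxE;
    case: (A _ _) => x y; case: (B _ _) => x' y' /=;
    by rewrite mul0r ?subr0 ?addr0.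
split => //.
- move=> M M'; rewrite !inE => -[X hX <-] [X' hX' <-] /eq_row_mx [/rowP eR /rowP eI].
  have up i j : lam j < lam i -> X i j = X' i j.
    move=> lt; have ijS : (i, j) \in S by [].
    have := eR (enum_rank_in ijS (i, j)).
    rewrite [LHS]mxE [RHS]mxE /ev enum_rankK_in //= => e1.
    have := eI (enum_rank_in ijS (i, j)).
    rewrite [LHS]mxE [RHS]mxE /ev enum_rankK_in //= => e2.
    have : adfield X D i j = adfield X' D i j.
      by apply/eqP; rewrite eq_complex e1 e2 !eqxx.
    by rewrite !adfield_diag -/c => /(mulfI (f0 _ _ lt)).
  apply/matrixP => i j; rewrite !adfield_diag.
  have [lt|lt|->] := ltgtP (lam i) (lam j); last by rewrite subrr mulr0 !mul0r.
    move/is_hermitianmxP: hX => ->; move/is_hermitianmxP: hX' => ->.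
    by rewrite !mxE (up _ _ lt).
  by rewrite (up _ _ lt).
- move=> u _.
  pose G (p : 'I_n * 'I_n) : R[i] :=
    if [pick k | ev k == p] is Some k then
      (lsubmx u 0 k +i* rsubmx u 0 k) / (c * (lam p.2 - lam p.1)%:C)
    else 0.
  pose X : 'M[R[i]]_n := \matrix_(i, j) (G (i, j) + Num.conj (G (j, i))).
  exists (adfield X D).
    exists X => //; apply/is_hermitianmxP; rewrite expr0 scale1r.
    by apply/matrixP => i j; rewrite !mxE rmorphD /= Num.Theory.conjCK addrC.
  have eX k : adfield X D (ev k).1 (ev k).2 = lsubmx u 0 k +i* rsubmx u 0 k.
    rewrite adfield_diag -/c mxE.
    have -> : G ((ev k).2, (ev k).1) = 0.
      rewrite /G; case: pickP => // k' /eqP e.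
      by have := evS k'; rewrite e /= ltNge ltW // evS.
    rewrite rmorph0 addr0 -surjective_pairing /G.
    case: pickP => [k' /eqP/evI ->|/(_ k)]; last by rewrite eqxx.
    by rewrite mulrC divfK // f0.
  by rewrite /P -[u in RHS]hsubmxK; congr row_mx; apply/rowP => k;
     rewrite [LHS]mxE eX.
Qed.

Lemma adfield_conj (R : realType) (n : nat) (U V X D : 'M[R[i]]_n) :
  V *m U = 1%:M -> V *m adfield X (U *m D *m V) *m U = adfield (V *m X *m U) D.
Proof.
move=> VU; rewrite /adfield -scalemxAr -scalemxAl mulmxBr mulmxBl.
have -> : V *m (X *m (U *m D *m V)) *m U = V *m X *m U *m D.
  by rewrite !mulmxA -[LHS]mulmxA VU mulmx1.
have -> // : V *m (U *m D *m V *m X) *m U = D *m (V *m X *m U).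
by rewrite !mulmxA VU mul1mx.
Qed.

(* The tangent spaces of the orbit have real dimension 2 * orbit_hdim lam.    *)
Lemma orbit_tangent_dim (R : realType) (n : nat) (lam : 'I_n -> R)
    (A : 'M[R[i]]_n) :
  let m := orbit_hdim lam in
  coadjoint_orbit lam A ->
  exists P : 'M[R[i]]_n -> 'rV[R]_(m + m),
    (forall (a : R) (B C : 'M[R[i]]_n), P (a%:C *: B + C) = a *: P B + P C) /\
    set_bij (orbit_tangent A) setT P.
Proof.
move=> m [U hU ->]; have := orbit_tangent_diag_dim lam; cbv zeta.
set D := diag_mx _ => -[P [linP [_ injP surP]]].
have UU : U^t* *m U = 1%:M by rewrite -invmx_unitary // mulVmx // unitarymx_unit.
have UU' : U *m U^t* = 1%:M by rewrite -invmx_unitary // mulmxV // unitarymx_unit.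
have hUt (V X : 'M[R[i]]_n) : X \is hermsymmx -> V^t* *m X *m V \is hermsymmx.
  move=> /is_hermitianmxP; rewrite expr0 scale1r => e.
  apply/is_hermitianmxP; rewrite expr0 scale1r.
  rewrite !trmx_mul !map_mxM -mulmxA /= -e; congr (_ *m (_ *m _)).
  by apply/matrixP => i j; rewrite !mxE Num.Theory.conjCK.
have hUt' (X : 'M[R[i]]_n) : X \is hermsymmx -> U *m X *m U^t* \is hermsymmx.
  have UK : (U^t*)^t* = U by apply/matrixP => i j; rewrite !mxE Num.Theory.conjCK.
  by move=> hX; have := hUt (U^t*) X hX; rewrite UK.
have {hUt} hUt := hUt U; clearbody D.
move: (U^t*) hUt hUt' UU UU' => V hUt hUt' UU UU'.
have UtT B : orbit_tangent (U *m D *m V) B -> orbit_tangent D (V *m B *m U).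
  by move=> [X hX <-]; exists (V *m X *m U); [exact: hUt | rewrite adfield_conj].
exists (fun B => P (V *m B *m U)); split.
  by move=> a B C; rewrite mulmxDr mulmxDl -scalemxAr -scalemxAl linP.
split; first by [].
- move=> B C /set_mem tB /set_mem tC eBC.
  have {}eBC : V *m B *m U = V *m C *m U.
    by apply: injP eBC; apply: mem_set; apply: UtT.
  have cK (Z : 'M[R[i]]_n) : U *m (V *m Z *m U) *m V = Z.
    by rewrite -!mulmxA UU' mulmx1 mulmxA UU' mul1mx.
  by rewrite -[B]cK eBC cK.
- move=> u uT; have [_ [X hX <-] <-] := surP u uT.
  exists (adfield (U *m X *m V) (U *m D *m V)).
    by exists (U *m X *m V) => //; apply: hUt'.
  rewrite adfield_conj //; congr (P (adfield _ D)).
  by rewrite -!mulmxA UU mulmx1 mulmxA UU mul1mx.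
Qed.

(* Main.v *)
Require Import Defs.
From HB Require Import structures.
From mathcomp Require Import all_boot all_order all_algebra.
From mathcomp Require Import spectral sesquilinear complex ring lra.
From mathcomp Require Import all_classical all_reals all_analysis.

(** Let a be the smallest positive gap between eigenvalues.  The ball of
capacity a is embedded by an explicit map, built up one block of equal
eigenvalues at a time; it comes from the description of the orbit as a
symplectic quotient of a space of rectangular matrices by unitary groups, in
which a slice for the group action is written down.

Let A be a d x d Hermitian matrix whose eigenvalues are the first d of the
lambda_i, and let the next block consist of m eigenvalues equal to t.  Then
B = A - t is positive definite, with spectrum at least a.  For every
(d + m) x d matrix F with F^* F = B, the matrix t + F F^* has the eigenvalues
of A and, m times more, the eigenvalue t ([extend_orbit]).  The map uses
those F whose top square block is positive definite: F = (H; Z) with Z an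
m x d complex matrix and H = sqrt (B - Z^* Z).  It exists as soon as
|Z|^2 < a, and the entries of Z are the coordinates added by the block.  When
all the blocks are exhausted there is one complex coordinate for each pair of
distinct eigenvalues, and the condition |Z|^2 < a holds for all blocks at once
on the ball.

The map is symplectic because the Kostant-Kirillov-Souriau form of F F^* is
that of F^* F plus (1 / pi) Im tr (dF^* dF') ([adfield_frame]).  Since H and
its derivatives are Hermitian, Im tr (dH dH') = 0, so only Z contributes, and
with Z = sqrt pi (x + i y) it contributes the sum of the dx /\ dy
([extend_symplectic]).

The map is injective with continuous inverse because t + F F^* has the blocks
t + H^2, H Z^* and Z H, from which H, then Z, then A = t + H^2 + Z^* Z are
read off.

The only analytic point is that the positive square root is smooth
([sqrtmx_smooth]).  If H^2 = M then dH solves the Sylvester equation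
H dH + dH H = dM, which is uniquely solvable for positive definite H; by
Cramer's rule dH is a rational function of H and dM, hence as regular as H,
and H gains derivatives one at a time, starting from an explicit Lipschitz
estimate. *)

Set Implicit Arguments.
Unset Strict Implicit.
Unset Printing Implicit Defensive.

Import Order.TTheory GRing.Theory Num.Theory.
Import numFieldNormedType.Exports.

Local Open Scope complex_scope.
Local Open Scope ring_scope.
Local Open Scope sesquilinear_scope.
Local Open Scope classical_set_scope.

(** * Positive definite matrices and their square roots *)

Section PositiveDefinite.
Context {C : numClosedFieldType}.

Lemma adjmxM m n p (A : 'M[C]_(m, n)) (B : 'M[C]_(n, p)) :
  (A *m B)^t* = B^t* *m A^t*.
Proof. by rewrite trmx_mul map_mxM. Qed.

Lemma adjmxD m n (A B : 'M[C]_(m, n)) : (A + B)^t* = A^t* + B^t*.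
Proof. by rewrite linearD map_mxD. Qed.

Lemma adjmxB m n (A B : 'M[C]_(m, n)) : (A - B)^t* = A^t* - B^t*.
Proof. by rewrite linearB map_mxB. Qed.

Lemma adjmxZ m n (c : C) (A : 'M[C]_(m, n)) : (c *: A)^t* = c^* *: A^t*.
Proof. by rewrite linearZ map_mxZ. Qed.

Lemma adjmx1 n : (1%:M : 'M[C]_n)^t* = 1%:M.
Proof. by rewrite trmx1 map_mx1. Qed.

Lemma adjmx0 m n : (0 : 'M[C]_(m, n))^t* = 0.
Proof. by rewrite trmx0 map_mx0. Qed.

Lemma adjmx_inv n (A : 'M[C]_n) : (invmx A)^t* = invmx (A^t*).
Proof. by rewrite trmx_inv map_invmx. Qed.

Lemma mxtrace_adj n (A : 'M[C]_n) : \tr (A^t*) = (\tr A)^*.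
Proof. by rewrite /mxtrace rmorph_sum; apply: eq_bigr => i _; rewrite !mxE. Qed.

Definition sqnorm m n (X : 'M[C]_(m, n)) : C := \tr (X *m X^t*).

Lemma sqnormE m n (X : 'M[C]_(m, n)) :
  sqnorm X = \sum_i \sum_j `|X i j| ^+ 2.
Proof.
apply: eq_bigr => i _; rewrite !mxE; apply: eq_bigr => j _.
by rewrite !mxE normCK.
Qed.

Lemma sqnorm_ge0 m n (X : 'M[C]_(m, n)) : 0 <= sqnorm X.
Proof. by rewrite sqnormE; do 2![apply: sumr_ge0 => ? _]; rewrite exprn_ge0. Qed.

Lemma sqnorm_entry m n (X : 'M[C]_(m, n)) i j : `|X i j| ^+ 2 <= sqnorm X.
Proof.
rewrite sqnormE (bigD1 i) //= (bigD1 j) //= -addrA lerDl addr_ge0 //.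
  by apply: sumr_ge0 => ? _; rewrite exprn_ge0.
by do 2![apply: sumr_ge0 => ? _]; rewrite exprn_ge0.
Qed.

Lemma sqnorm_eq0 m n (X : 'M[C]_(m, n)) : sqnorm X = 0 -> X = 0.
Proof.
move=> X0; apply/matrixP => i j; rewrite mxE; apply/eqP.
have := sqnorm_entry X i j; rewrite X0 => le0.
by rewrite -normr_eq0 -sqrf_eq0 eq_le le0 exprn_ge0.
Qed.

Lemma sqnorm_rV n (u : 'rV[C]_n) : sqnorm u = (u *m u^t*) 0 0.
Proof. by rewrite /sqnorm /mxtrace big_ord1. Qed.

Lemma sqnorm_row m n (X : 'M[C]_(m, n)) : sqnorm X = \sum_i sqnorm (row i X).
Proof.
rewrite sqnormE; apply: eq_bigr => i _; rewrite sqnormE big_ord1.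
by apply: eq_bigr => j _; rewrite mxE.
Qed.

Lemma sqnorm_adj m n (X : 'M[C]_(m, n)) : sqnorm (X^t*) = sqnorm X.
Proof. by rewrite /sqnorm trmxCK mxtrace_mulC. Qed.

Definition qform n (A : 'M[C]_n) (u : 'rV[C]_n) : C := (u *m A *m u^t*) 0 0.

Lemma qformB n (A B : 'M[C]_n) u :
  qform (A - B) u = qform A u - qform B u.
Proof. by rewrite /qform mulmxBr mulmxBl !mxE. Qed.

Lemma qform_gram m n (Z : 'M[C]_(m, n)) u :
  qform (Z^t* *m Z) u = sqnorm (u *m Z^t*).
Proof. by rewrite sqnorm_rV adjmxM trmxCK /qform !mulmxA. Qed.

Definition posdef n (A : 'M[C]_n) : Prop :=
  A^t* = A /\ forall u : 'rV[C]_n, u != 0 -> 0 < qform A u.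

Lemma posdef_adj n (A : 'M[C]_n) : posdef A -> A^t* = A.
Proof. by case. Qed.

Lemma mxtrace_qform m n (A : 'M[C]_n) (X : 'M[C]_(m, n)) :
  \tr (X *m A *m X^t*) = \sum_i qform A (row i X).
Proof.
apply: eq_bigr => i _; rewrite /qform -!row_mul !mxE.
by apply: eq_bigr => j _; rewrite !mxE.
Qed.

Lemma qform_ge0 n (A : 'M[C]_n) u : posdef A -> 0 <= qform A u.
Proof.
move=> [_ pA]; have [->|/pA/ltW //] := eqVneq u 0.
by rewrite /qform !mul0mx mxE.
Qed.

Lemma posdef_tr_ge0 m n (A : 'M[C]_n) (X : 'M[C]_(m, n)) :
  posdef A -> 0 <= \tr (X *m A *m X^t*).
Proof. by move=> pA; rewrite mxtrace_qform sumr_ge0 // => i _; exact: qform_ge0. Qed.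

Lemma posdef_tr_eq0 m n (A : 'M[C]_n) (X : 'M[C]_(m, n)) :
  posdef A -> \tr (X *m A *m X^t*) = 0 -> X = 0.
Proof.
move=> pA; rewrite mxtrace_qform => /eqP; rewrite psumr_eq0; last first.
  by move=> i _; exact: qform_ge0.
move=> /allP q0; apply/row_matrixP => i; rewrite row0; apply/eqP/negPn/negP.
move=> /(pA.2) ; have /(_ (mem_index_enum i))/implyP/(_ isT)/eqP -> := q0 i.
by rewrite ltxx.
Qed.

Lemma posdef_unit n (A : 'M[C]_n) : posdef A -> A \in unitmx.
Proof.
move=> pA; rewrite -row_free_unit -kermx_eq0; apply/eqP.
by apply: (posdef_tr_eq0 pA); rewrite mulmx_ker mul0mx mxtrace0.
Qed.

Lemma qform_diag n (P : 'M[C]_n) (d : 'rV[C]_n) (u : 'rV[C]_n) :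
  qform (P^t* *m diag_mx d *m P) u = \sum_i d 0 i * `|(u *m P^t*) 0 i| ^+ 2.
Proof.
rewrite /qform !mulmxA -mulmxA -{2}[P]trmxCK -adjmxM mxE.
apply: eq_bigr => i _; rewrite mul_mx_diag [in LHS]mxE !mxE normCK.
by rewrite mulrAC mulrC.
Qed.

Lemma posdef_diag n (P : 'M[C]_n) (d : 'rV[C]_n) :
  P \is unitarymx -> (forall i, 0 < d 0 i) ->
  posdef (P^t* *m diag_mx d *m P).
Proof.
move=> hP d0; split.
  rewrite !adjmxM trmxCK mulmxA; congr (_ *m _ *m _).
  rewrite tr_diag_mx map_diag_mx; congr diag_mx.
  by apply/rowP => i; rewrite mxE; apply/CrealP/ger0_real/ltW.
move=> u u0; set v := u *m P^t*.
rewrite qform_diag -/v.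
have v0 : v != 0.
  apply: contra u0 => /eqP v0; apply/eqP.
  by rewrite -[u](mulmxKtV _ hP) // -/v v0 mul0mx.
rewrite lt_neqAle sumr_ge0 ?andbT; last first.
  by move=> i _; rewrite mulr_ge0 ?exprn_ge0 // ltW.
apply: contra v0; rewrite eq_sym psumr_eq0; last first.
  by move=> i _; rewrite mulr_ge0 ?exprn_ge0 // ltW.
move=> /allP q0; apply/eqP/rowP => i; rewrite [RHS]mxE; apply/eqP.
have /(_ (mem_index_enum i))/implyP/(_ isT) := q0 i.
by rewrite mulf_eq0 gt_eqF ?d0 //= sqrf_eq0 normr_eq0.
Qed.

Lemma hermsymmxP n (A : 'M[C]_n) : reflect (A^t* = A) (A \is hermsymmx).
Proof.
by apply: (iffP (is_hermitianmxP _ _ _)); rewrite expr0 scale1r => /esym.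
Qed.

Lemma posdef_spectral n (A : 'M[C]_n) : posdef A ->
  A = (spectralmx A)^t* *m diag_mx (spectral_diag A) *m spectralmx A /\
  forall i, 0 < spectral_diag A 0 i.
Proof.
move=> [hA pA]; have /orthomx_spectralP eA : A \is normalmx.
  by apply: hermitian_normalmx; apply/hermsymmxP.
have hP := spectral_unitarymx A.
rewrite invmx_unitary // in eA; split => // i.
set P := spectralmx A in eA hP *; set d := spectral_diag A in eA *.
have PP : P *m P^t* = 1%:M by apply/unitarymxP.
have eAP : P *m A *m P^t* = diag_mx d.
  by rewrite eA !mulmxA PP mul1mx -mulmxA PP mulmx1.
have /pA : row i P != 0.
  apply/eqP => P0; have := congr1 (fun M => row i M) PP.
  rewrite row_mul P0 mul0mx row1 => /rowP/(_ i).
  by rewrite !mxE !eqxx => /esym/eqP; rewrite oner_eq0.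
have -> // : qform A (row i P) = d 0 i.
have /matrixP/(_ i i) := eAP; rewrite [in RHS]mxE eqxx mulr1n => <-.
rewrite /qform -!row_mul !mxE; apply: eq_bigr => j _.
by rewrite !mxE.
Qed.

Definition sqrtmx n (A : 'M[C]_n) : 'M[C]_n :=
  (spectralmx A)^t* *m diag_mx (map_mx sqrtC (spectral_diag A)) *m spectralmx A.

Lemma sqrtmx_posdef n (A : 'M[C]_n) : posdef A -> posdef (sqrtmx A).
Proof.
move=> /posdef_spectral[_ d0]; apply: posdef_diag.
  exact: spectral_unitarymx.
by move=> i; rewrite mxE sqrtC_gt0.
Qed.

Lemma sqrtmxK n (A : 'M[C]_n) : posdef A -> sqrtmx A *m sqrtmx A = A.
Proof.
move=> /posdef_spectral[eA d0]; rewrite [RHS]eA /sqrtmx.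
have PP : spectralmx A *m (spectralmx A)^t* = 1%:M.
  exact/unitarymxP/spectral_unitarymx.
set P := spectralmx A in PP *; rewrite !mulmxA -[_ *m P *m P^t*]mulmxA PP mulmx1.
congr (_ *m _); rewrite -mulmxA; congr (_ *m _); rewrite mulmx_diag.
by congr diag_mx; apply/rowP => i; rewrite !mxE -expr2 sqrtCK.
Qed.

(** A finite-dimensional positive definite form dominates a multiple of the
norm; the matrix version, with X in place of a vector, is its sum over the
rows of X. *)
Lemma posdef_coercive n (A : 'M[C]_n) : posdef A ->
  exists2 e : C, 0 < e & forall m (X : 'M[C]_(m, n)),
    e * sqnorm X <= \tr (X *m A *m X^t*).
Proof.
move=> /posdef_spectral[eA d0].
set P := spectralmx A in eA *; set d := spectral_diag A in eA d0 *.
have hP : P \is unitarymx by exact: spectral_unitarymx.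
have [e e0 ed] : exists2 e : C, 0 < e & forall i, e <= d 0 i.
  (* a positive lower bound of the eigenvalues which also makes sense, and is
     positive, for the empty matrix *)
  exists (1 + \sum_i (d 0 i)^-1)^-1.
    by rewrite invr_gt0 ltr_wpDr // sumr_ge0 // => i _; rewrite invr_ge0 ltW.
  move=> i; rewrite -[d 0 i]invrK lef_pV2 ?posrE ?invr_gt0 //; last first.
    by rewrite ltr_wpDr // sumr_ge0 // => k _; rewrite invr_ge0 ltW.
  rewrite (bigD1 i) //= addrCA lerDl addr_ge0 // sumr_ge0 // => k _.
  by rewrite invr_ge0 ltW.
exists e => // m X; rewrite [sqnorm X]sqnorm_row mxtrace_qform mulr_sumr.
apply: ler_sum => i _; set u := row i X.
have -> : sqnorm u = sqnorm (u *m P^t*).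
  by rewrite /sqnorm adjmxM trmxCK !mulmxA mulmxKtV.
rewrite sqnormE big_ord1 eA qform_diag mulr_sumr.
by apply: ler_sum => j _; apply: ler_wpM2r; rewrite ?exprn_ge0.
Qed.

Lemma coercive_posdef n (A : 'M[C]_n) (e : C) : A^t* = A -> 0 < e ->
  (forall u, e * sqnorm u <= qform A u) -> posdef A.
Proof.
move=> hA e0 eA; split=> // u u0; apply: lt_le_trans (eA u).
rewrite mulr_gt0 // lt_neqAle sqnorm_ge0 andbT eq_sym.
by apply: contra u0 => /eqP/sqnorm_eq0 ->.
Qed.

Lemma sylvester_tr n (H H' X : 'M[C]_n) :
  \tr (X^t* *m (H *m X + X *m H')) =
  \tr (X^t* *m H *m X^t*^t*) + \tr (X *m H' *m X^t*).
Proof.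
rewrite trmxCK mulmxDr mxtraceD !mulmxA; congr (_ + _).
by rewrite [RHS]mxtrace_mulC mulmxA.
Qed.

(** Quantitative injectivity of the Sylvester operator X |-> H X + X H': pairing
the image with X bounds it below by e |X|^2, and the bound on norms follows
from |e X - Y|^2 >= 0.  It gives the continuity of the square root. *)
Lemma sylvester_bound n (H H' : 'M[C]_n) (e : C) :
  0 < e -> (forall X : 'M[C]_n, e * sqnorm X <= \tr (X *m H *m X^t*)) ->
  posdef H' -> forall X, e ^+ 2 * sqnorm X <= sqnorm (H *m X + X *m H').
Proof.
move=> e0 eH pH' X; set Y := H *m X + X *m H'; set t := \tr (X^t* *m Y).
have le_t : e * sqnorm X <= t.
  rewrite /t sylvester_tr -[sqnorm X]sqnorm_adj.
  by apply: (le_trans (eH _)); rewrite lerDl posdef_tr_ge0.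
have t_ge0 : 0 <= t by apply: le_trans le_t; rewrite mulr_ge0 ?sqnorm_ge0 // ltW.
have t' : \tr (Y *m X^t*) = t by rewrite mxtrace_mulC.
have t'' : \tr (X *m Y^t*) = t.
  rewrite -{1}[X]trmxCK -adjmxM mxtrace_adj t'.
  exact/CrealP/ger0_real.
have ej : e^* = e by apply/CrealP/gtr0_real.
have eq1 : sqnorm (e *: X - Y) = e ^+ 2 * sqnorm X - 2%:R * (e * t) + sqnorm Y.
  rewrite {1}/sqnorm adjmxB adjmxZ ej mulmxBl !mulmxBr -!scalemxAl -!scalemxAr.
  rewrite !linearB /= !mxtraceZ t' t'' -/(sqnorm X) -/(sqnorm Y); ring.
have le2 : e ^+ 2 * sqnorm X <= e * t.
  by rewrite expr2 -mulrA ler_wpM2l // ltW.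
have eq2 : sqnorm Y - e ^+ 2 * sqnorm X =
    sqnorm (e *: X - Y) + (e * t - e ^+ 2 * sqnorm X) *+ 2.
  by rewrite eq1; ring.
by rewrite -subr_ge0 eq2 addr_ge0 ?sqnorm_ge0 // mulrn_wge0 // subr_ge0.
Qed.

(** Both terms of the pairing with X are nonnegative, so both vanish. *)
Lemma sylvester_inj n (H H' X : 'M[C]_n) :
  posdef H -> posdef H' -> H *m X + X *m H' = 0 -> X = 0.
Proof.
move=> pH pH' eX; have := sylvester_tr H H' X.
rewrite eX mulmx0 mxtrace0 => /esym/eqP.
rewrite paddr_eq0 ?posdef_tr_ge0 // => /andP[_ /eqP].
exact: posdef_tr_eq0.
Qed.

(** The difference of two square roots of the same matrix is in the kernel of
their Sylvester operator. *)
Lemma posdef_sqr_inj n (H H' : 'M[C]_n) :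
  posdef H -> posdef H' -> H *m H = H' *m H' -> H = H'.
Proof.
move=> pH pH' e; apply/subr0_eq/(sylvester_inj pH pH').
by rewrite mulmxBr mulmxBl e addrA subrK subrr.
Qed.

Lemma CauchySchwarz_mx m n (u : 'rV[C]_n) (Z : 'M[C]_(m, n)) :
  sqnorm (u *m Z^t*) <= sqnorm u * sqnorm Z.
Proof.
rewrite [sqnorm Z]sqnorm_row mulr_sumr sqnormE big_ord1.
apply: ler_sum => i _.
have := (CauchySchwarz (@dotmx C n : {dot _ for _}) u (row i Z)).1.
have -> : (u *m Z^t*) 0 i = dotmx u (row i Z).
  by rewrite dotmxE !mxE; apply: eq_bigr => j _; rewrite !mxE.
by rewrite !sqnorm_rV -!dotmxE.
Qed.
End PositiveDefinite.

(** * The symplectic reduction step: from F^* F to F F^* *)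

Section Frames.
Context {C : numClosedFieldType}.

Lemma adjmx_col m1 m2 n (A : 'M[C]_(m1, n)) (B : 'M[C]_(m2, n)) :
  (col_mx A B)^t* = row_mx (A^t*) (B^t*).
Proof. by rewrite tr_col_mx map_row_mx. Qed.

Lemma adjmx_row m n1 n2 (A : 'M[C]_(m, n1)) (B : 'M[C]_(m, n2)) :
  (row_mx A B)^t* = col_mx (A^t*) (B^t*).
Proof. by rewrite tr_row_mx map_col_mx. Qed.

Lemma col_gram d m (H : 'M[C]_d) (Z : 'M[C]_(m, d)) :
  (col_mx H Z)^t* *m col_mx H Z = H^t* *m H + Z^t* *m Z.
Proof. by rewrite adjmx_col mul_row_col. Qed.

(** F F^* is unitarily conjugate to F^* F bordered by zeros.  The columns of
F B^(-1/2) are orthonormal, and they are completed to a unitary matrix by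
orthonormalizing in the same way the columns of G, which span the orthogonal
of the columns of F.  The explicit shape of G uses that the top block of F is
invertible. *)
Lemma frame_unitary d m (H : 'M[C]_d) (Z : 'M[C]_(m, d)) (B : 'M[C]_d) :
    H \in unitmx -> posdef B ->
    (col_mx H Z)^t* *m col_mx H Z = B ->
  exists2 U : 'M[C]_(d + m), U \is unitarymx &
    col_mx H Z *m (col_mx H Z)^t* = U *m block_mx B 0 0 0 *m U^t*.
Proof.
move=> uH pB; set F := col_mx H Z => FB.
pose L := - ((invmx H)^t* *m Z^t*).
pose G : 'M[C]_(d + m, m) := col_mx L 1%:M.
pose K := G^t* *m G.
have FG : F^t* *m G = 0.
  rewrite /F /G adjmx_col mul_row_col mulmx1 /L mulmxN mulmxA -adjmxM mulVmx //.
  by rewrite adjmx1 mul1mx addNr.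
have GF : G^t* *m F = 0 by rewrite -[F]trmxCK -adjmxM FG adjmx0.
have pK : posdef K.
  apply: (@coercive_posdef _ _ _ 1) => //.
    by rewrite /K adjmxM trmxCK.
  move=> u; rewrite mul1r /K /qform mulmxA -mulmxA.
  have -> : G *m u^t* = (u *m G^t*)^t* by rewrite adjmxM trmxCK.
  rewrite -sqnorm_rV /G adjmx_col adjmx1 mul_mx_row mulmx1.
  rewrite {2}/sqnorm adjmx_row mul_row_col mxtraceD -/(sqnorm _) -/(sqnorm u).
  by rewrite lerDr sqnorm_ge0.
have [uB uK] := (posdef_unit (sqrtmx_posdef pB), posdef_unit (sqrtmx_posdef pK)).
have hB := posdef_adj (sqrtmx_posdef pB); have hK := posdef_adj (sqrtmx_posdef pK).
have eB := sqrtmxK pB; have eK := sqrtmxK pK.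
move: (sqrtmx B) (sqrtmx K) uB uK hB hK eB eK => b k ub uk hb hk eb ek.
pose U : 'M[C]_(d + m) := row_mx (F *m invmx b) (G *m invmx k).
have Ut : U^t* = col_mx (invmx b *m F^t*) (invmx k *m G^t*).
  by rewrite /U adjmx_row !adjmxM !adjmx_inv hb hk.
have UU : U^t* *m U = 1%:M.
  rewrite Ut /U mul_col_row -!mulmxA ![_^t* *m (_ *m _)]mulmxA FG GF FB -/K.
  rewrite !mul0mx !mulmx0 -eb -ek -!mulmxA !mulmxV // !mulmx1 !mulVmx //.
  by rewrite -scalar_mx_block.
exists U; first by apply/unitarymxP/mulmx1C.
rewrite Ut /U mul_row_block !mulmx0 !addr0 mul_row_col mul0mx addr0.
by rewrite -eb -!mulmxA [invmx b *m (b *m _)]mulmxA mulVmx // mul1mx mulKVmx.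
Qed.

(** A Hermitian X is prescribed on the range of F; the condition on F^* S is what
makes this compatible with X being Hermitian, and P^* S^* - P^* F^* S P, where
P is the left inverse of F, is the correction that makes S P Hermitian without
changing its values on the range of F. *)
Lemma hermitian_solve k d (F S : 'M[C]_(k, d)) :
    F^t* *m F \in unitmx -> (F^t* *m S)^t* = F^t* *m S ->
  exists2 X : 'M[C]_k, X^t* = X & X *m F = S.
Proof.
move=> uB hS; set B := F^t* *m F in uB.
have hS' : S^t* *m F = F^t* *m S by rewrite -hS adjmxM trmxCK.
pose P := invmx B *m F^t*.
have PF : P *m F = 1%:M by rewrite /P -mulmxA mulVmx.
clearbody P; exists (S *m P + P^t* *m S^t* - P^t* *m (F^t* *m S) *m P).
  rewrite adjmxB adjmxD !adjmxM !trmxCK [_ + S *m P]addrC; congr (_ - _).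
  by rewrite hS' !mulmxA.
by rewrite mulmxBl mulmxDl -!mulmxA PF !mulmx1 hS' addrK.
Qed.
End Frames.

Section SymplecticStep.
Context {R : realType}.
Local Notation C := R[i].

Lemma cRe_conj (z : C) : complex.Re (z^*) = complex.Re z.
Proof. by case: z. Qed.

Lemma cIm_conj (z : C) : complex.Im (z^*) = - complex.Im z.
Proof. by case: z. Qed.

Lemma tr_hermitian_im n (H H' : 'M[C]_n) :
  H^t* = H -> H'^t* = H' -> complex.Im (\tr (H *m H')) = 0.
Proof.
move=> h h'; have : \tr (H *m H') = (\tr (H *m H'))^*.
  by rewrite -mxtrace_adj adjmxM h h' mxtrace_mulC.
move=> /(congr1 (@complex.Im R)); rewrite cIm_conj; lra.
Qed.

Lemma adfield_shift n (X A : 'M[C]_n) (a : C) : adfield X (A + a%:M) = adfield X A.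
Proof.
rewrite /adfield mulmxDr mulmxDl mul_mx_scalar mul_scalar_mx.
by rewrite opprD addrACA subrr addr0.
Qed.

(** Reduction in stages for the Kostant-Kirillov-Souriau form.  A velocity dF
moves F^* F by the infinitesimal rotation Y; the rotation X that moves F F^* is
found by requiring dF = 2 pi i (X F - F Y), so that dF is the joint action of X
and Y on F.  Evaluating -tr X on another velocity then gives the flat form of
dF and dF' and the value of -tr Y at the level of F^* F. *)
Lemma adfield_frame k d (F dF : 'M[C]_(k, d)) (Y : 'M[C]_d) :
    F^t* *m F \in unitmx -> Y^t* = Y ->
    adfield Y (F^t* *m F) = dF^t* *m F + F^t* *m dF ->
  exists X : 'M[C]_k, [/\ X^t* = X,
    adfield X (F *m F^t*) = dF *m F^t* + F *m dF^t* &
    forall dF' : 'M[C]_(k, d),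
      - complex.Re (\tr (X *m (dF' *m F^t* + F *m dF'^t*))) =
      pi^-1 * complex.Im (\tr (dF^t* *m dF'))
      - complex.Re (\tr (Y *m (dF'^t* *m F + F^t* *m dF')))].
Proof.
move=> uB hY; rewrite /adfield; set kp : C := Complex 0 (2 * pi) => eY.
have pi0 : pi != 0 :> R by rewrite gt_eqF // pi_gt0.
have k0 : kp != 0.
  by rewrite eq_complex /= negb_and orbC mulf_neq0.
have kj : kp^* = - kp by apply/eqP; rewrite eq_complex /= oppr0 !eqxx.
have kvj : (kp^-1)^* = - kp^-1 by rewrite fmorphV /= kj invrN.
(* the value X F must take for dF = 2 pi i (X F - F Y) *)
pose S := kp^-1 *: dF + F *m Y.
have FS : F^t* *m S = kp^-1 *: (F^t* *m dF) + F^t* *m F *m Y.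
  by rewrite /S mulmxDr -scalemxAr mulmxA.
have hS : (F^t* *m S)^t* = F^t* *m S.
  rewrite FS adjmxD adjmxZ kvj !adjmxM !trmxCK hY.
  apply/eqP; rewrite -subr_eq0 scaleNr opprD addrACA -opprD -scalerDr.
  rewrite -eY scalerA mulVf // scale1r; apply/eqP.
  by rewrite addNr.
have [X hX XF] := hermitian_solve uB hS.
have FX : F^t* *m X = S^t* by rewrite -XF adjmxM hX.
have St : S^t* = - kp^-1 *: dF^t* + Y *m F^t*.
  by rewrite /S adjmxD adjmxZ kvj adjmxM hY.
exists X; split=> // [|dF'].
  rewrite mulmxA XF -[F *m F^t* *m X]mulmxA FX St /S mulmxDl mulmxDr.
  rewrite -scalemxAl -scalemxAr mulmxA opprD addrACA subrr addr0 scaleNr opprK.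
  by rewrite -scalerDr scalerA mulfV // scale1r.
have eX : complex.Re (\tr (X *m (dF' *m F^t* + F *m dF'^t*))) =
    2 * complex.Re (\tr (S^t* *m dF')).
  rewrite mulmxDr mxtraceD raddfD /= [X *m (F *m _)]mulmxA XF.
  rewrite mulmxA mxtrace_mulC mulmxA FX.
  rewrite [\tr (S *m _)]mxtrace_mulC -[dF'^t* *m S]trmxCK mxtrace_adj.
  by rewrite adjmxM trmxCK cRe_conj; ring.
have eY' : complex.Re (\tr (Y *m (dF'^t* *m F + F^t* *m dF'))) =
    2 * complex.Re (\tr (Y *m F^t* *m dF')).
  rewrite mulmxDr mxtraceD raddfD /= [Y *m (F^t* *m _)]mulmxA.
  rewrite mulmxA mxtrace_mulC mulmxA -[F *m Y *m _]trmxCK mxtrace_adj.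
  rewrite !adjmxM trmxCK hY cRe_conj mxtrace_mulC; ring.
rewrite eX eY' St mulmxDl mxtraceD raddfD /= -scalemxAl mxtraceZ.
have -> : complex.Re (- kp^-1 * \tr (dF^t* *m dF')) =
    - (2 * pi)^-1 * complex.Im (\tr (dF^t* *m dF')).
  have -> : - kp^-1 = Complex 0 (2 * pi)^-1.
    apply: (mulfI k0); rewrite mulrN mulfV //.
    apply/eqP; rewrite eq_complex /= !mul0r mulr0 addr0 sub0r oppr0.
    by rewrite mulfV ?eqxx // mulf_neq0.
  by case: (\tr _) => a b /=; ring.
by move: pi0; generalize (@pi R) => p p0; field.
Qed.
End SymplecticStep.

(** * Differential calculus *)

Section Differentials.
Context {R : realType} {V W : normedModType R}.
Implicit Types (f g h : V -> W) (x : V) (U : set V).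

(** The common root of two facts on differentials: that they only depend on the
germ of the function, and that a product of a function vanishing continuously
and one vanishing differentiably has derivative zero. *)
Lemma negligible_diff h x : h x = 0 ->
    (forall e : R, 0 < e -> \forall y \near x, `|h y| <= e * `|y - x|) ->
  differentiable h x /\ 'd h x = 0 :> (V -> W).
Proof.
move=> h0 hle.
have o0 : h \o shift x = cst (h x) + (0 : V -> W) +o_ 0 id.
  apply/eqaddoP => e e0; rewrite near_simpl.
  have := hle e e0; rewrite (near_shift 0 x) subr0 => hle'.
  apply: filterS hle' => y /=.
  have -> : (h \o shift x - (cst (h x) + (0 : V -> W))) y = h (y + x).
    by rewrite h0; change (h (y + x) - (0 + 0) = h (y + x)); rewrite addr0 subr0.
  by rewrite addrK.
have c0 : continuous (0 : V -> W) by exact: cst_continuous.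
have d0 : 'd h x = 0 :> (V -> W).
  by rewrite (@diff_unique _ _ _ h (\0 : {linear V -> W}) x).
split => //; apply/diff_locallyP; rewrite d0; split => //.
Qed.

Lemma near_diff f g x : (\forall y \near x, f y = g y) -> differentiable f x ->
  differentiable g x /\ 'd g x = 'd f x :> (V -> W).
Proof.
move=> fg df; have fgx : f x = g x := nbhs_singleton fg.
have [dh eh] : differentiable (g - f) x /\ 'd (g - f) x = 0 :> (V -> W).
  apply: negligible_diff => [|e e0]; first by rewrite !fctE fgx subrr.
  apply: filterS fg => y; rewrite !fctE => ->; rewrite subrr normr0.
  by rewrite mulr_ge0 // ltW.
have -> : g = f + (g - f) by rewrite addrC subrK.
split; first exact: differentiableD.
apply/funext => y; apply: etrans (congr1 (@^~ y) (diffD df dh)) _.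
by apply: etrans (congr1 (+%R _) (congr1 (@^~ y) eh)) _; exact: addr0.
Qed.

Lemma diff_lip f x : differentiable f x ->
  exists2 K : R, 0 < K & \forall y \near x, `|f y - f x| <= K * `|y - x|.
Proof.
move=> df; have [k k0 lek] := linear_lipschitz (diff_continuous df).
exists (k + 1); first by rewrite addr_gt0.
have /eqaddoP/(_ 1 ltr01) := diff_locally df; rewrite near_simpl => h.
rewrite (near_shift 0 x) subr0; apply: filterS h => y /=.
rewrite !fctE /= addrK mul1r opprD addrA => le1.
rewrite -[f _ - _](subrK ('d f x y)) mulrDl mul1r addrC.
by rewrite (le_trans (ler_normD _ _)) // lerD.
Qed.

End Differentials.

Section Ck.
Context {R : realType} {V : normedModType R}.
Implicit Types (x : V) (U : set V).

Lemma Ck_on_ext (W : normedModType R) k U (f g : V -> W) : open U ->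
  (forall x, U x -> f x = g x) -> Ck_on k U f -> Ck_on k U g.
Proof.
move=> oU; elim: k f g => [|k IHk] f g fg /=.
  move=> fc x Ux; have near_fg : \forall y \near x, f y = g y.
    by apply: filterS (open_nbhs_nbhs (conj oU Ux)) => y /fg.
  change (g y @[y --> x] --> g x); rewrite -(fg _ Ux).
  exact: (cvg_trans (near_eq_cvg near_fg) (fc x Ux)).
move=> [df Cf]; have dfg x : U x -> differentiable g x /\ 'd g x = 'd f x :> (V -> W).
  move=> Ux; apply: near_diff (df _ Ux).
  by apply: filterS (open_nbhs_nbhs (conj oU Ux)) => y /fg.
split => [x /dfg[]//|v]; apply: IHk (Cf v) => x /dfg[_ ->].
by [].
Qed.

Lemma Ck_on_cst (W : normedModType R) k U (c : W) : Ck_on k U (fun _ : V => c).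
Proof.
elim: k c => [|k IHk] c /=; first by move=> x _; exact: cvg_cst.
split=> [x _|v]; first exact: differentiable_cst.
by under [fun x => _]funext do rewrite diff_cst.
Qed.

Lemma Ck_on_le (W : normedModType R) k U (f : V -> W) :
  Ck_on k.+1 U f -> Ck_on k U f.
Proof.
elim: k f => [|k IHk] f [df Cf]; first by move=> x /df/differentiable_continuous.
by split => // v; apply: IHk.
Qed.

Lemma Ck_on_add (W : normedModType R) k U (f g : V -> W) : open U ->
  Ck_on k U f -> Ck_on k U g -> Ck_on k U (fun x => f x + g x).
Proof.
move=> oU; elim: k f g => [|k IHk] f g /=.
  by move=> cf cg x Ux; apply: continuousD; [exact: cf|exact: cg].
move=> [df Cf] [dg Cg]; split=> [x Ux|v].
  by apply: differentiableD; [exact: df|exact: dg].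
apply: Ck_on_ext (IHk _ _ (Cf v) (Cg v)) => // x Ux.
exact: esym (congr1 (@^~ v) (diffD (df x Ux) (dg x Ux))).
Qed.

Lemma Ck_on_scalel (W : normedModType R) k U (f : V -> R) (w : W) : open U ->
  Ck_on k U f -> Ck_on k U (fun x => f x *: w).
Proof.
move=> oU; elim: k f => [|k IHk] f /=.
  by move=> cf x Ux; apply: cvgZr_tmp; exact: cf.
move=> [df Cf]; split=> [x Ux|v]; first exact/differentiableZl/df.
apply: Ck_on_ext (IHk _ (Cf v)) => // x Ux.
exact: esym (congr1 (@^~ v) (diffZl w (df x Ux))).
Qed.

Lemma Ck_on_mul k U (f g : V -> R) : open U ->
  Ck_on k U f -> Ck_on k U g -> Ck_on k U (fun x => f x * g x).
Proof.
move=> oU; elim: k f g => [|k IHk] f g.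
  by move=> cf cg x Ux; apply: continuousM; [exact: cf|exact: cg].
move=> Cf Cg; have [Cf' Cg'] := (Ck_on_le Cf, Ck_on_le Cg).
case: Cf => df Cf; case: Cg => dg Cg; split=> [x Ux|v].
  by apply: differentiableM; [exact: df|exact: dg].
apply: Ck_on_ext (Ck_on_add oU (IHk _ _ Cf' (Cg v)) (IHk _ _ Cg' (Cf v))) => //.
by move=> x Ux; exact: esym (congr1 (@^~ v) (diffM (df x Ux) (dg x Ux))).
Qed.

Lemma Ck_on_inv k U (f : V -> R) : open U -> (forall x, U x -> f x != 0) ->
  Ck_on k U f -> Ck_on k U (fun x => (f x)^-1).
Proof.
move=> oU f0; elim: k => [|k IHk].
  by move=> cf x Ux; apply: continuousV; [exact: f0|exact: cf].
move=> Cf; have Cv := IHk (Ck_on_le Cf).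
case: Cf => df Cf; split=> [x Ux|v].
  by apply: differentiableV; [exact: df|exact: f0].
have Cm := Ck_on_mul oU (Ck_on_cst k U (-1 : R)) (Ck_on_mul oU Cv Cv).
apply: Ck_on_ext (Ck_on_mul oU Cm (Cf v)) => // x Ux.
apply: etrans (esym (congr1 (@^~ v) (diffV (df x Ux) (f0 x Ux)))).
by rewrite mulN1r -invfM -expr2.
Qed.

Lemma Ck_on_linear (W : normedModType R) k U (f : {linear V -> W}) :
  continuous f -> Ck_on k U f.
Proof.
move=> cf; case: k => [|k]; first by move=> x _; exact: cf.
split=> [x _|v]; first exact: linear_differentiable.
by under [fun x => _]funext do rewrite diff_lin //; exact: Ck_on_cst.
Qed.

End Ck.

(** Caratheodory's criterion: a function is differentiable when its increment is
that of a differentiable function times a continuous factor. *)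
Lemma diff_caratheodory (R : realType) (V : normedModType R) (phi m : V -> R)
    (x : V) : {for x, continuous phi} -> differentiable m x ->
  differentiable (fun y => phi y * (m y - m x)) x.
Proof.
move=> cphi dm; have [K K0 leK] := diff_lip dm.
have [dh _] : differentiable (fun y => (phi y - phi x) * (m y - m x)) x /\
    'd (fun y => (phi y - phi x) * (m y - m x)) x = 0 :> (V -> R).
  apply: negligible_diff => [|e e0]; first by rewrite !subrr mulr0.
  have : \forall y \near x, `|phi x - phi y| < e / K.
    by move/cvgrPdist_lt : cphi; apply; rewrite divr_gt0.
  move=> near_phi; apply: filterS2 leK near_phi => y le1 /ltW le2.
  rewrite normrM distrC (le_trans (ler_pM _ _ le2 le1)) //.
  by rewrite mulrA divfK // gt_eqF.
have -> : (fun y => phi y * (m y - m x)) =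
    (fun y => (phi y - phi x) * (m y - m x)) + (phi x \*: (m - cst (m x))).
  by apply/funext => y; rewrite !fctE /= mulrBl [_ *: _]/(_ * _) subrK.
by apply: differentiableD => //; apply: differentiableZ; apply: differentiableB.
Qed.

(** * Algebras of functions, and matrices with entries in them *)

(** The same rational expressions are needed twice: on an open set, where they
must be of class C^k, and on the image of the embedding, where they must be
continuous for the induced topology.  This interface covers both; it is
relative to a set D on which functions are compared and denominators must not
vanish. *)
Record function_algebra (R : realType) (T : Type) (D : set T)
    (P : (T -> R) -> Prop) : Prop := FunctionAlgebra {
  fa_ext : forall f g, (forall t, D t -> f t = g t) -> P f -> P g;
  fa_cst : forall c, P (fun=> c);
  fa_add : forall f g, P f -> P g -> P (fun t => f t + g t);
  fa_mul : forall f g, P f -> P g -> P (fun t => f t * g t);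
  fa_inv : forall f, (forall t, D t -> f t != 0) -> P f -> P (fun t => (f t)^-1)
}.

Lemma Ck_on_algebra (R : realType) (V : normedModType R) k (U : set V) :
  open U -> function_algebra U (@Ck_on R V R k U).
Proof.
move=> oU; split.
- by move=> f g; exact: Ck_on_ext.
- by move=> c; exact: Ck_on_cst.
- by move=> f g; exact: Ck_on_add.
- by move=> f g; exact: Ck_on_mul.
- by move=> f; exact: Ck_on_inv.
Qed.

Definition continuous_in (R : realType) (T : topologicalType) (D : set T)
    (f : T -> R) : Prop :=
  forall x, D x -> f @ within D (nbhs x) --> f x.

Lemma continuous_in_algebra (R : realType) (T : topologicalType) (D : set T) :
  function_algebra D (@continuous_in R T D).
Proof.
split.
- move=> f g fg cf x Dx; rewrite -(fg _ Dx).
  apply: cvg_trans (cf x Dx); apply: near_eq_cvg.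
  by apply: filterS (withinT D (nbhs_filter x)) => y /fg.
- by move=> c x _; exact: cvg_cst.
- by move=> f g cf cg x Dx; apply: cvgD; [exact: cf|exact: cg].
- by move=> f g cf cg x Dx; apply: cvgM; [exact: cf|exact: cg].
- by move=> f f0 cf x Dx; apply: cvgV; [exact: f0|exact: cf].
Qed.

Lemma continuous_in_open (R : realType) (V : normedModType R) (U : set V)
    (f : V -> R) : open U -> continuous_in U f <-> Ck_on 0 U f.
Proof.
move=> oU; have wE x : U x -> within U (nbhs x) = nbhs x.
  by move=> Ux; apply: within_interior; exact: open_nbhs_nbhs (conj oU Ux).
by split=> cf x Ux; have := cf x Ux; rewrite wE.
Qed.

Section Complexwise.
Context {R : realType} {T : Type} {D : set T} {P : (T -> R) -> Prop}.
Hypothesis FA : function_algebra D P.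
Local Notation C := R[i].

Definition complexwise (f : T -> C) : Prop :=
  P (fun t => complex.Re (f t)) /\ P (fun t => complex.Im (f t)).

Definition entrywise m n (M : T -> 'M[C]_(m, n)) : Prop :=
  forall i j, complexwise (fun t => M t i j).

Let Pext f g : (forall t, f t = g t) -> P f -> P g.
Proof. by move=> fg; apply: (fa_ext FA) => t _; exact: fg. Qed.

Lemma complexwise_ext f g : (forall t, D t -> f t = g t) ->
  complexwise f -> complexwise g.
Proof.
by move=> fg [Pr Pi]; split; [move: Pr|move: Pi];
  apply: (fa_ext FA) => t Dt; rewrite fg.
Qed.

Lemma complexwise_cst c : complexwise (fun=> c).
Proof. by split; exact: (fa_cst FA). Qed.

Lemma complexwise_add f g : complexwise f -> complexwise g ->
  complexwise (fun t => f t + g t).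
Proof.
move=> [fr fi] [gr gi]; split.
  by apply: Pext (fa_add FA fr gr) => t; rewrite raddfD.
by apply: Pext (fa_add FA fi gi) => t; rewrite raddfD.
Qed.

Lemma complexwise_mul f g : complexwise f -> complexwise g ->
  complexwise (fun t => f t * g t).
Proof.
move=> [fr fi] [gr gi]; have N := fa_mul FA (fa_cst FA (-1)); split.
  apply: Pext (fa_add FA (fa_mul FA fr gr) (N _ (fa_mul FA fi gi))) => t.
  by case: (f t) (g t) => a b [c d] /=; rewrite mulN1r.
apply: Pext (fa_add FA (fa_mul FA fr gi) (fa_mul FA fi gr)) => t.
by case: (f t) (g t) => a b [c d].
Qed.

Lemma complexwise_conj f : complexwise f -> complexwise (fun t => (f t)^*).
Proof.
move=> [fr fi]; split; first by apply: Pext fr => t; rewrite cRe_conj.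
by apply: Pext (fa_mul FA (fa_cst FA (-1)) fi) => t; rewrite cIm_conj mulN1r.
Qed.

Lemma complexwise_inv f : (forall t, D t -> f t != 0) -> complexwise f ->
  complexwise (fun t => (f t)^-1).
Proof.
move=> f0 Pf; have [Pg _] := complexwise_mul Pf (complexwise_conj Pf).
have Pgv : complexwise (fun t => (complex.Re (f t * (f t)^*))^-1%:C%C).
  split; last exact: (fa_cst FA 0).
  apply: (fa_inv FA) Pg => t /f0 ft0; rewrite -normCK.
  rewrite -(add_Re2_Im2 (f t)) /= paddr_eq0 ?sqr_ge0 // !sqrf_eq0.
  by move: ft0; rewrite eq_complex.
apply: complexwise_ext (complexwise_mul Pgv (complexwise_conj Pf)) => t Dt.
have ft0 := f0 t Dt; apply: (mulfI ft0); rewrite mulfV // mulrCA.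
have cj0 : f t * (f t)^* != 0 by rewrite mulf_neq0 // fmorph_eq0.
have eC : (complex.Re (f t * (f t)^*))%:C%C = f t * (f t)^*.
  by rewrite -normCK -add_Re2_Im2.
move: eC cj0; move: (f t * _) => w; set r := complex.Re w => <- w0.
have r0 : r != 0 by apply: contra w0 => /eqP ->.
by apply/eqP; rewrite eq_complex /= mulVf // !mul0r mulr0 subr0 addr0 !eqxx.
Qed.

Lemma complexwise_sum I (r : seq I) (Q : pred I) (F : I -> T -> C) :
  (forall i, Q i -> complexwise (F i)) ->
  complexwise (fun t => \sum_(i <- r | Q i) F i t).
Proof.
move=> PF; elim: r => [|i r IHr].
  by apply: complexwise_ext (complexwise_cst 0) => t _; rewrite big_nil.
have [Qi|nQi] := boolP (Q i).
  apply: complexwise_ext (complexwise_add (PF i Qi) IHr) => t _.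
  by rewrite big_cons Qi.
by apply: complexwise_ext IHr => t _; rewrite big_cons (negbTE nQi).
Qed.

Lemma complexwise_prod I (r : seq I) (F : I -> T -> C) :
  (forall i, complexwise (F i)) -> complexwise (fun t => \prod_(i <- r) F i t).
Proof.
move=> PF; elim: r => [|i r IHr].
  by apply: complexwise_ext (complexwise_cst 1) => t _; rewrite big_nil.
by apply: complexwise_ext (complexwise_mul (PF i) IHr) => t _; rewrite big_cons.
Qed.

Lemma entrywise_ext m n (M N : T -> 'M[C]_(m, n)) :
  (forall t, D t -> M t = N t) -> entrywise M -> entrywise N.
Proof.
by move=> MN PM i j; apply: complexwise_ext (PM i j) => t /MN ->.
Qed.

Lemma entrywise_cst m n (A : 'M[C]_(m, n)) : entrywise (fun=> A).
Proof. by move=> i j; exact: complexwise_cst. Qed.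

Lemma entrywise_add m n (M N : T -> 'M[C]_(m, n)) :
  entrywise M -> entrywise N -> entrywise (fun t => M t + N t).
Proof.
move=> PM PN i j; apply: complexwise_ext (complexwise_add (PM i j) (PN i j)).
by move=> t _; rewrite mxE.
Qed.

Lemma entrywise_mul m n p (M : T -> 'M[C]_(m, n)) (N : T -> 'M[C]_(n, p)) :
  entrywise M -> entrywise N -> entrywise (fun t => M t *m N t).
Proof.
move=> PM PN i k.
apply: (@complexwise_ext (fun t => \sum_j M t i j * N t j k)).
  by move=> t _; rewrite mxE.
by apply: complexwise_sum => j _; exact: complexwise_mul.
Qed.

Lemma entrywise_scale m n (f : T -> C) (M : T -> 'M[C]_(m, n)) :
  complexwise f -> entrywise M -> entrywise (fun t => f t *: M t).
Proof.
move=> Pf PM i j; apply: complexwise_ext (complexwise_mul Pf (PM i j)).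
by move=> t _; rewrite mxE.
Qed.

Lemma entrywise_opp m n (M : T -> 'M[C]_(m, n)) :
  entrywise M -> entrywise (fun t => - M t).
Proof.
move=> PM; apply: entrywise_ext (entrywise_scale (complexwise_cst (-1)) PM).
by move=> t _; rewrite scaleN1r.
Qed.

Lemma entrywise_adj m n (M : T -> 'M[C]_(m, n)) :
  entrywise M -> entrywise (fun t => (M t)^t*).
Proof.
move=> PM i j; apply: complexwise_ext (complexwise_conj (PM j i)).
by move=> t _; rewrite !mxE.
Qed.

Lemma entrywise_sub m n p q (f : 'I_p -> 'I_m) (g : 'I_q -> 'I_n)
    (M : T -> 'M[C]_(m, n)) :
  entrywise M -> entrywise (fun t => mxsub f g (M t)).
Proof.
move=> PM i j; apply: complexwise_ext (PM (f i) (g j)).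
by move=> t _; rewrite mxE.
Qed.

Lemma entrywise_col m1 m2 n (M : T -> 'M[C]_(m1, n)) (N : T -> 'M[C]_(m2, n)) :
  entrywise M -> entrywise N -> entrywise (fun t => col_mx (M t) (N t)).
Proof.
move=> PM PN i j; rewrite -(splitK i); case: (fintype.split i) => k /=.
  by apply: complexwise_ext (PM k j) => t _; rewrite col_mxEu.
by apply: complexwise_ext (PN k j) => t _; rewrite col_mxEd.
Qed.

Lemma entrywise_mxvec m n (M : T -> 'M[C]_(m, n)) :
  entrywise M -> entrywise (fun t => mxvec (M t)).
Proof.
move=> PM i k; rewrite (ord1 i); case/mxvec_indexP: k => a b.
by apply: complexwise_ext (PM a b) => t _; rewrite mxvecE.
Qed.

Lemma entrywise_vec_mx m n (M : T -> 'rV[C]_(m * n)) :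
  entrywise M -> entrywise (fun t => vec_mx (M t)).
Proof.
move=> PM i j; apply: complexwise_ext (PM 0 (mxvec_index i j)) => t _.
by rewrite mxE.
Qed.

Lemma complexwise_det n (M : T -> 'M[C]_n) :
  entrywise M -> complexwise (fun t => \det (M t)).
Proof.
move=> PM; apply: complexwise_sum => s _; apply: complexwise_mul.
  exact: complexwise_cst.
by apply: complexwise_prod => i; exact: PM.
Qed.

(** Cramer's rule. *)
Lemma entrywise_inv n (M : T -> 'M[C]_n) :
  (forall t, D t -> M t \in unitmx) -> entrywise M ->
  entrywise (fun t => invmx (M t)).
Proof.
move=> uM PM.
apply: (@entrywise_ext _ _ (fun t => (\det (M t))^-1 *: \adj (M t))).
  by move=> t /uM Mu; rewrite /invmx Mu.
apply: entrywise_scale.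
  apply: complexwise_inv (complexwise_det PM) => t /uM.
  by rewrite unitmxE unitfE.
move=> i j; apply: (@complexwise_ext (fun t => (-1) ^+ (j + i) *
  \det (mxsub (lift j) (lift i) (M t)))).
  move=> t _; rewrite mxE /cofactor; congr (_ * \det _).
  by apply/matrixP => a b; rewrite !mxE.
apply: complexwise_mul; first exact: complexwise_cst.
exact/complexwise_det/entrywise_sub.
Qed.

End Complexwise.
Arguments complexwise {R T} P f.
Arguments entrywise {R T} P {m n} M.

Section Sylvester.
Context {C : numClosedFieldType}.

(** The matrix of X |-> H X + X H' acting on the row vectors [mxvec X]; as a matrix,
it has an inverse whose entries are rational in those of H and H'. *)
Definition sylvmx n (H H' : 'M[C]_n) : 'M[C]_(n * n) :=
  lin_mulmx H + lin_mulmxr H'.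

Lemma mul_sylvmx n (H H' X : 'M[C]_n) :
  mxvec X *m sylvmx H H' = mxvec (H *m X + X *m H').
Proof. by rewrite mulmxDr !mul_vec_lin linearD. Qed.

Lemma sylvmx_unit n (H H' : 'M[C]_n) :
  posdef H -> posdef H' -> sylvmx H H' \in unitmx.
Proof.
move=> pH pH'; rewrite -row_free_unit -kermx_eq0; apply/eqP/row_matrixP => i.
rewrite row0; set v := row i _.
have : v *m sylvmx H H' = 0 by rewrite -row_mul mulmx_ker row0.
rewrite -[v]vec_mxK mul_sylvmx => /(congr1 vec_mx).
rewrite mxvecK linear0 => v0.
by rewrite (sylvester_inj pH pH' v0) linear0.
Qed.

Lemma sylvester_solve n (H H' X : 'M[C]_n) : posdef H -> posdef H' ->
  X = vec_mx (mxvec (H *m X + X *m H') *m invmx (sylvmx H H')).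
Proof.
by move=> pH pH'; rewrite -mul_sylvmx mulmxK ?mxvecK // sylvmx_unit.
Qed.
End Sylvester.

Lemma entrywise_sylvmx (R : realType) (T : Type) (D : set T) P n
    (H H' : T -> 'M[R[i]]_n) : function_algebra D P ->
  entrywise P H -> entrywise P H' -> entrywise P (fun t => sylvmx (H t) (H' t)).
Proof.
move=> FA PH PH'; apply: (entrywise_add FA) => i j.
  apply: (@complexwise_ext _ _ _ _ FA
    (fun t => mxvec (H t *m vec_mx (delta_mx 0 i)) 0 j)).
    by move=> t _; rewrite !mxE.
  by apply: (entrywise_mxvec FA); apply: (entrywise_mul FA) => //;
    exact: (entrywise_cst FA).
apply: (@complexwise_ext _ _ _ _ FA
  (fun t => mxvec (vec_mx (delta_mx 0 i) *m H' t) 0 j)).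
  by move=> t _; rewrite !mxE.
by apply: (entrywise_mxvec FA); apply: (entrywise_mul FA) => //;
    exact: (entrywise_cst FA).
Qed.

(** * Differentials of matrix-valued functions *)

Section MatrixDifferential.
Context {R : realType} {V : normedModType R}.
Local Notation C := R[i].
Implicit Types (x v : V) (U : set V).

Definition diff_at x (f : V -> R) : Prop := differentiable f x.

Lemma diff_at_algebra U x : open U -> U x ->
  function_algebra U (diff_at x).
Proof.
move=> oU Ux; split.
- move=> f g fg df; apply: (near_diff _ df).1.
  by apply: filterS (open_nbhs_nbhs (conj oU Ux)) => y /fg.
- by move=> c; exact: differentiable_cst.
- by move=> f g; exact: differentiableD.
- by move=> f g; exact: differentiableM.
- by move=> f f0 df; apply: differentiableV => //; exact: f0.
Qed.

(** A constant of its own for the scalar directional derivative makes rewriting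
by the rules below syntactic. *)
Definition ddiff (f : V -> R) x v : R := 'd f x v.

Lemma ddiff_eq f g x v : (forall y, f y = g y) -> ddiff f x v = ddiff g x v.
Proof. by move=> /funext ->. Qed.

Lemma ddiff_ext U f g x v : open U -> U x -> (forall y, U y -> f y = g y) ->
  diff_at x f -> ddiff f x v = ddiff g x v.
Proof.
move=> oU Ux fg df; apply: esym (congr1 (@^~ v) (near_diff _ df).2).
by apply: filterS (open_nbhs_nbhs (conj oU Ux)) => y /fg.
Qed.

Lemma ddiff_cst c x v : ddiff (fun=> c) x v = 0.
Proof. exact: (congr1 (@^~ v) (diff_cst _ _)). Qed.

Lemma ddiff_add f g x v : diff_at x f -> diff_at x g ->
  ddiff (fun y => f y + g y) x v = ddiff f x v + ddiff g x v.
Proof. by move=> df dg; exact: (congr1 (@^~ v) (diffD df dg)). Qed.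

Lemma ddiff_opp f x v : diff_at x f -> ddiff (fun y => - f y) x v = - ddiff f x v.
Proof. by move=> df; exact: (congr1 (@^~ v) (diffN df)). Qed.

Lemma ddiff_mul f g x v : diff_at x f -> diff_at x g ->
  ddiff (fun y => f y * g y) x v = ddiff f x v * g x + f x * ddiff g x v.
Proof.
move=> df dg; apply: etrans (congr1 (@^~ v) (diffM df dg)) _.
by apply: etrans (addrC _ _) _; congr (_ + _); exact: mulrC.
Qed.

Definition cdiff (f : V -> C) x v : C :=
  Complex (ddiff (fun y => complex.Re (f y)) x v)
          (ddiff (fun y => complex.Im (f y)) x v).

Definition mxdiff m n (M : V -> 'M[C]_(m, n)) x v : 'M[C]_(m, n) :=
  \matrix_(i, j) cdiff (fun y => M y i j) x v.

Lemma cdiff_ext U f g x v : open U -> U x -> (forall y, U y -> f y = g y) ->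
  complexwise (diff_at x) f -> cdiff f x v = cdiff g x v.
Proof.
move=> oU Ux fg [df df']; apply: (f_equal2 (@Complex R)).
  by apply: (ddiff_ext _ oU Ux _ df) => y /fg ->.
by apply: (ddiff_ext _ oU Ux _ df') => y /fg ->.
Qed.

Lemma cdiff_cst c x v : cdiff (fun=> c) x v = 0.
Proof. by rewrite /cdiff !ddiff_cst. Qed.

Lemma cdiff_add f g x v : complexwise (diff_at x) f -> complexwise (diff_at x) g ->
  cdiff (fun y => f y + g y) x v = cdiff f x v + cdiff g x v.
Proof.
move=> [fr fi] [gr gi]; apply/eqP; rewrite eq_complex /=.
apply/andP; split; apply/eqP; [rewrite -(ddiff_add v fr gr)|rewrite -(ddiff_add v fi gi)];
  by apply: ddiff_eq => y; rewrite raddfD.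
Qed.

Lemma cdiff_conj f x v : complexwise (diff_at x) f ->
  cdiff (fun y => (f y)^*) x v = (cdiff f x v)^*.
Proof.
move=> [fr fi]; apply/eqP; rewrite eq_complex cRe_conj cIm_conj /=.
apply/andP; split; apply/eqP; last rewrite -(ddiff_opp v fi);
  by apply: ddiff_eq => y; rewrite ?cRe_conj ?cIm_conj.
Qed.

Lemma cdiff_mul f g x v : complexwise (diff_at x) f -> complexwise (diff_at x) g ->
  cdiff (fun y => f y * g y) x v = cdiff f x v * g x + f x * cdiff g x v.
Proof.
move=> [fr fi] [gr gi]; apply/eqP; rewrite eq_complex /=.
have dm (a b : V -> R) : diff_at x a -> diff_at x b ->
    diff_at x (fun y => a y * b y) by exact: differentiableM.
have dn (a : V -> R) : diff_at x a -> diff_at x (fun y => - a y).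
  exact: differentiableN.
have mulE y : f y * g y = Complex
    (complex.Re (f y) * complex.Re (g y) + - (complex.Im (f y) * complex.Im (g y)))
    (complex.Re (f y) * complex.Im (g y) + complex.Im (f y) * complex.Re (g y)).
  by case: (f y) (g y) => a b [c d].
rewrite !raddfD /=.
apply/andP; split; apply/eqP.
  rewrite (ddiff_eq _ _ (fun y => congr1 (@complex.Re R) (mulE y))) /=.
  rewrite ddiff_add; [|exact: dm|exact/dn/dm].
  rewrite (ddiff_opp _ (dm _ _ fi gi)) (ddiff_mul _ fr gr) (ddiff_mul _ fi gi).
  case: (f x) (g x) => a b [c d] /=.
  by do 4!(move: (ddiff _ x v) => ?); ring.
rewrite (ddiff_eq _ _ (fun y => congr1 (@complex.Im R) (mulE y))) /=.
rewrite ddiff_add; [|exact: dm|exact: dm].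
rewrite (ddiff_mul _ fr gi) (ddiff_mul _ fi gr).
case: (f x) (g x) => a b [c d] /=.
by do 4!(move: (ddiff _ x v) => ?); ring.
Qed.

Lemma cdiff_sum (I : Type) (r : seq I) (F : I -> V -> C) x v :
  (forall i, complexwise (diff_at x) (F i)) ->
  cdiff (fun y => \sum_(i <- r) F i y) x v = \sum_(i <- r) cdiff (F i) x v.
Proof.
move=> dF; have FA := diff_at_algebra openT (Logic.I : setT x).
elim: r => [|i r IHr].
  rewrite big_nil -[RHS](cdiff_cst 0 x v); congr (cdiff _ x v).
  by apply/funext => y; rewrite big_nil.
rewrite big_cons -IHr -cdiff_add //; last by apply: (complexwise_sum FA).
by congr (cdiff _ x v); apply/funext => y; rewrite big_cons.
Qed.

Lemma mxdiff_ext U m n (M N : V -> 'M[C]_(m, n)) x v : open U -> U x ->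
  (forall y, U y -> M y = N y) -> entrywise (diff_at x) M ->
  mxdiff M x v = mxdiff N x v.
Proof.
move=> oU Ux MN dM; apply/matrixP => i j; rewrite !mxE.
by apply: (cdiff_ext _ oU Ux _ (dM i j)) => y /MN ->.
Qed.

Lemma mxdiff_cst m n (A : 'M[C]_(m, n)) x v : mxdiff (fun=> A) x v = 0.
Proof. by apply/matrixP => i j; rewrite !mxE cdiff_cst. Qed.

Lemma mxdiff_add m n (M N : V -> 'M[C]_(m, n)) x v :
  entrywise (diff_at x) M -> entrywise (diff_at x) N ->
  mxdiff (fun y => M y + N y) x v = mxdiff M x v + mxdiff N x v.
Proof.
move=> dM dN; apply/matrixP => i j; rewrite !mxE -cdiff_add //.
by congr (cdiff _ x v); apply/funext => y; rewrite mxE.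
Qed.

Lemma mxdiff_mul m n p (M : V -> 'M[C]_(m, n)) (N : V -> 'M[C]_(n, p)) x v :
  entrywise (diff_at x) M -> entrywise (diff_at x) N ->
  mxdiff (fun y => M y *m N y) x v = mxdiff M x v *m N x + M x *m mxdiff N x v.
Proof.
move=> dM dN; have FA := diff_at_algebra openT (Logic.I : setT x).
apply/matrixP => i k; rewrite !mxE -big_split /=.
transitivity (cdiff (fun y => \sum_j M y i j * N y j k) x v).
  by congr (cdiff _ x v); apply/funext => y; rewrite mxE.
rewrite cdiff_sum; last by move=> j; apply: (complexwise_mul FA).
by apply: eq_bigr => j _; rewrite cdiff_mul // !mxE.
Qed.

Lemma mxdiff_adj m n (M : V -> 'M[C]_(m, n)) x v : entrywise (diff_at x) M ->
  mxdiff (fun y => (M y)^t*) x v = (mxdiff M x v)^t*.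
Proof.
move=> dM; apply/matrixP => i j; rewrite !mxE -cdiff_conj //.
by congr (cdiff _ x v); apply/funext => y; rewrite !mxE.
Qed.

Lemma mxdiff_col m1 m2 n (M : V -> 'M[C]_(m1, n)) (N : V -> 'M[C]_(m2, n)) x v :
  mxdiff (fun y => col_mx (M y) (N y)) x v = col_mx (mxdiff M x v) (mxdiff N x v).
Proof.
apply/matrixP => i j; rewrite -(splitK i); case: (fintype.split i) => k /=.
  rewrite col_mxEu !mxE; congr (cdiff _ x v).
  by apply/funext => y; rewrite col_mxEu.
rewrite col_mxEd !mxE; congr (cdiff _ x v).
by apply/funext => y; rewrite col_mxEd.
Qed.

Lemma Ck_on_mxdiff k U m n (M : V -> 'M[C]_(m, n)) v :
  entrywise (@Ck_on R V R k.+1 U) M ->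
  entrywise (@Ck_on R V R k U) (fun x => mxdiff M x v).
Proof.
move=> CM i j; have [[_ Cr] [_ Ci]] := CM i j; split.
  by have := Cr v; congr Ck_on; apply/funext => x; rewrite mxE.
by have := Ci v; congr Ck_on; apply/funext => x; rewrite mxE.
Qed.

Lemma Ck_on_diff_at k U m n (M : V -> 'M[C]_(m, n)) x : U x ->
  entrywise (@Ck_on R V R k.+1 U) M -> entrywise (diff_at x) M.
Proof.
move=> Ux CM i j; have [[dr _] [di _]] := CM i j.
by split; [exact: dr|exact: di].
Qed.

End MatrixDifferential.

(** * Smoothness of the positive square root *)

Section SquareRoot.
Context {R : realType}.
Local Notation C := R[i].

Lemma submx_entry m n (A B : 'M[C]_(m, n)) i j : (A - B) i j = A i j - B i j.
Proof. by rewrite !mxE. Qed.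

Definition resqnorm m n (A : 'M[C]_(m, n)) : R :=
  \sum_i \sum_j (complex.Re (A i j) ^+ 2 + complex.Im (A i j) ^+ 2).

Lemma resqnorm_ge0 p q (A : 'M[C]_(p, q)) : 0 <= resqnorm A.
Proof. by do 2![apply: sumr_ge0 => ? _]; rewrite addr_ge0 // sqr_ge0. Qed.

Lemma sqnorm_real m n (A : 'M[C]_(m, n)) : sqnorm A = (resqnorm A)%:C%C.
Proof.
rewrite sqnormE rmorph_sum; apply: eq_bigr => i _.
by rewrite rmorph_sum; apply: eq_bigr => j _; rewrite -add_Re2_Im2.
Qed.

(** The difference of the square roots is the solution of a Sylvester equation
whose right-hand side is A - B. *)
Lemma sqrtmx_lipschitz n (A : 'M[C]_n) : posdef A ->
  exists2 e : R, 0 < e & forall B, posdef B -> forall i j,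
    e ^+ 2 * (complex.Re ((sqrtmx A - sqrtmx B) i j) ^+ 2 +
              complex.Im ((sqrtmx A - sqrtmx B) i j) ^+ 2) <= resqnorm (A - B).
Proof.
move=> pA; have [e e0 leE] := posdef_coercive (sqrtmx_posdef pA).
have eE : e = (complex.Re e)%:C%C.
  by rewrite RRe_real //; exact: gtr0_real.
have re0 : 0 < complex.Re e by rewrite -ltcR -eE.
exists (complex.Re e) => // B pB i j.
have := sylvester_bound e0 (leE n) (sqrtmx_posdef pB) (sqrtmx A - sqrtmx B).
have -> : sqrtmx A *m (sqrtmx A - sqrtmx B) + (sqrtmx A - sqrtmx B) *m sqrtmx B = A - B.
  by rewrite mulmxBr mulmxBl (sqrtmxK pA) (sqrtmxK pB) addrA subrK.
rewrite [sqnorm (A - B)]sqnorm_real => le1.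
have := sqnorm_entry (sqrtmx A - sqrtmx B) i j => le2.
have le3 : e ^+ 2 * `|(sqrtmx A - sqrtmx B) i j| ^+ 2 <= (resqnorm (A - B))%:C%C.
  by apply: le_trans le1; apply: ler_wpM2l le2; rewrite exprn_ge0 // ltW.
by move: le3; rewrite -add_Re2_Im2 eE -rmorphXn -rmorphM lecR.
Qed.

Lemma sqrtmx_continuous_in (T : topologicalType) (D : set T) n
    (M : T -> 'M[C]_n) : (forall t, D t -> posdef (M t)) ->
  entrywise (@continuous_in R T D) M ->
  entrywise (@continuous_in R T D) (fun t => sqrtmx (M t)).
Proof.
move=> pM cM i j.
suff key x : D x -> forall e : R, 0 < e -> \forall y \near within D (nbhs x),
    complex.Re ((sqrtmx (M x) - sqrtmx (M y)) i j) ^+ 2 +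
    complex.Im ((sqrtmx (M x) - sqrtmx (M y)) i j) ^+ 2 < e ^+ 2.
  have sq_lt (a b e : R) : 0 < e -> 0 <= b -> a ^+ 2 + b < e ^+ 2 -> `|a| < e.
    move=> e0 b0 lt1; rewrite -(ltr_pXn2r (ltn0Sn 1)) ?nnegrE ?(ltW e0) //.
    by rewrite real_normK ?num_real // (le_lt_trans _ lt1) // lerDl.
  have ReB (a b : C) : complex.Re (a - b) = complex.Re a - complex.Re b.
    by case: a b => ? ? [].
  have ImB (a b : C) : complex.Im (a - b) = complex.Im a - complex.Im b.
    by case: a b => ? ? [].
  split=> x Dx; apply/cvgrPdist_lt => e e0; apply: filterS (key x Dx e e0) => y.
    rewrite submx_entry => lt1; rewrite -ReB; exact: sq_lt e0 (sqr_ge0 _) lt1.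
  rewrite submx_entry addrC => lt1; rewrite -ImB; exact: sq_lt e0 (sqr_ge0 _) lt1.
move=> Dx e e0; have [d d0 led] := sqrtmx_lipschitz (pM x Dx).
have FA := continuous_in_algebra R D.
pose N y := resqnorm (M x - M y).
have cN : continuous_in D N.
  have cS (I : Type) (r : seq I) (F : I -> T -> R) :
      (forall i, continuous_in D (F i)) -> continuous_in D (fun y => \sum_(i <- r) F i y).
    move=> cF; elim: r => [|k r IHr].
      by apply: (fa_ext FA) (fa_cst FA 0) => t _; rewrite big_nil.
    by apply: (fa_ext FA) (fa_add FA (cF k) IHr) => t _; rewrite big_cons.
  apply: (@cS _ _ _) => a; apply: (@cS _ _ _) => b.
  have [cr ci] := entrywise_add FA (entrywise_cst FA (M x)) (entrywise_opp FA cM) a b.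
  exact: (fa_add FA) (fa_mul FA cr cr) (fa_mul FA ci ci).
have N0 : N x = 0.
  rewrite /N subrr /resqnorm big1 // => a _; rewrite big1 // => b _.
  by rewrite mxE expr0n /= addr0.
have := cN x Dx; rewrite N0 => /cvgr0Pnorm_lt/(_ (d ^+ 2 * e ^+ 2)).
rewrite mulr_gt0 ?exprn_gt0 // => /(_ isT) nearN.
apply: filterS2 (withinT D (nbhs_filter x)) nearN => y Dy ltN.
have := led _ (pM y Dy) i j => leN.
rewrite -(ltr_pM2l (exprn_gt0 2 d0)); apply: le_lt_trans leN _.
exact: le_lt_trans (ler_norm _) ltN.
Qed.

Lemma complex_caratheodory (V : normedModType R) (phi m : V -> C) (x : V) :
    {for x, continuous (fun y => complex.Re (phi y))} ->
    {for x, continuous (fun y => complex.Im (phi y))} ->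
    complexwise (diff_at x) m ->
  complexwise (diff_at x) (fun y => (m y - m x) * phi y).
Proof.
move=> cr ci [dr di]; split.
  have := differentiableB (diff_caratheodory cr dr) (diff_caratheodory ci di).
  congr diff_at; apply/funext => y; rewrite -[LHS]/(_ - _).
  by case: (m y) (m x) (phi y) => a b [c d] [p q] /=; ring.
have := differentiableD (diff_caratheodory ci dr) (diff_caratheodory cr di).
congr diff_at; apply/funext => y; rewrite -[LHS]/(_ + _).
by case: (m y) (m x) (phi y) => a b [c d] [p q] /=; ring.
Qed.

(** Continuity comes from the Lipschitz estimate.  Differentiability at x is
Caratheodory's criterion: S y - S x is the solution of a Sylvester equation
with right-hand side M y - M x and an operator depending continuously on y.
The differential then solves a Sylvester equation as well, so that it is C^k
when S is, and S is C^(k+1). *)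
Lemma sqrtmx_smooth (V : normedModType R) (U : set V) n (M : V -> 'M[C]_n) :
    open U -> (forall x, U x -> posdef (M x)) ->
    (forall k, entrywise (@Ck_on R V R k U) M) ->
  forall k, entrywise (@Ck_on R V R k U) (fun x => sqrtmx (M x)).
Proof.
move=> oU pM CM; pose S x := sqrtmx (M x).
have pS x : U x -> posdef (S x) by move=> Ux; apply/sqrtmx_posdef/pM.
have S2 x : U x -> S x *m S x = M x by move=> Ux; apply/sqrtmxK/pM.
have C0 : entrywise (@Ck_on R V R 0 U) S.
  have : entrywise (@continuous_in R V U) S.
    apply: sqrtmx_continuous_in pM _ => i j; have [cr ci] := CM 0%N i j.
    by split; apply/continuous_in_open.
  by move=> cS i j; have [cr ci] := cS i j; split; apply/continuous_in_open.
have FA0 := Ck_on_algebra 0 oU.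
have dS x : U x -> entrywise (diff_at x) S.
  move=> Ux; have FAx := diff_at_algebra oU Ux.
  pose K y := invmx (sylvmx (S x) (S y)).
  have cK : entrywise (@Ck_on R V R 0 U) K.
    apply: (entrywise_inv FA0) => [y Uy|]; first exact: sylvmx_unit (pS _ Ux) (pS _ Uy).
    exact: (entrywise_sylvmx FA0 (entrywise_cst FA0 (S x)) C0).
  have eS y : U y -> S y = S x + vec_mx (mxvec (M y - M x) *m K y).
    move=> Uy; rewrite -[LHS](subrK (S x)) addrC; congr (_ + _).
    rewrite [LHS](sylvester_solve _ (pS x Ux) (pS y Uy)) mulmxBr mulmxBl.
    by rewrite (S2 x Ux) (S2 y Uy) addrC addrA subrK.
  apply: (entrywise_ext FAx (M := fun y => S x + vec_mx (mxvec (M y - M x) *m K y))).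
    by move=> y /eS.
  apply: (entrywise_add FAx); first exact: (entrywise_cst FAx).
  apply: (entrywise_vec_mx FAx) => i j.
  apply: (complexwise_ext FAx (f := fun y => \sum_k
      (mxvec (M y) 0 k - mxvec (M x) 0 k) * K y k j)).
    move=> y _; rewrite mxE; apply: eq_bigr => k _.
    by rewrite (ord1 i) linearB submx_entry.
  apply: (complexwise_sum FAx) => k _.
  apply: (@complex_caratheodory V (fun y => K y k j) (fun y => mxvec (M y) 0 k)).
  - exact: (cK k j).1.
  - exact: (cK k j).2.
  - exact: (entrywise_mxvec FAx) (Ck_on_diff_at Ux (CM 1%N)) 0 k.
have eD x v : U x ->
    mxdiff S x v = vec_mx (mxvec (mxdiff M x v) *m invmx (sylvmx (S x) (S x))).
  move=> Ux; have e : mxdiff S x v *m S x + S x *m mxdiff S x v = mxdiff M x v.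
    transitivity (mxdiff (fun y => S y *m S y) x v).
      exact: esym (mxdiff_mul v (dS x Ux) (dS x Ux)).
    apply: (mxdiff_ext v oU Ux S2).
    exact: (entrywise_mul (diff_at_algebra oU Ux)) (dS x Ux) (dS x Ux).
  apply: etrans (sylvester_solve _ (pS x Ux) (pS x Ux)) _.
  by rewrite addrC e.
elim=> [|k IHk]; first exact: C0.
have FA := Ck_on_algebra k oU.
have CD v : entrywise (@Ck_on R V R k U) (fun x => mxdiff S x v).
  apply: (entrywise_ext FA) => [x Ux|]; first exact: esym (eD x v Ux).
  apply: (entrywise_vec_mx FA); apply: (entrywise_mul FA).
    by apply: (entrywise_mxvec FA); exact: Ck_on_mxdiff (CM k.+1).
  apply: (entrywise_inv FA) => [x Ux|]; first exact: sylvmx_unit (pS x Ux) (pS x Ux).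
  exact: (entrywise_sylvmx FA IHk IHk).
move=> i j; split.
  split=> [x Ux|v]; first exact: (dS x Ux i j).1.
  by have [+ _] := CD v i j; congr Ck_on; apply/funext => x; rewrite mxE.
split=> [x Ux|v]; first exact: (dS x Ux i j).2.
by have [_ +] := CD v i j; congr Ck_on; apply/funext => x; rewrite mxE.
Qed.
End SquareRoot.

Section OrbitBounds.
Context {R : realType}.
Local Notation C := R[i].

Lemma coadjoint_orbit_coercive n (lam : 'I_n -> R) (A : 'M[C]_n) (t c : R) :
    coadjoint_orbit lam A -> (forall i, t + c <= lam i) ->
  (A - t%:C%:M)^t* = A - t%:C%:M /\
  forall u, c%:C * sqnorm u <= qform (A - t%:C%:M) u.
Proof.
move=> [W hW ->] le_lam; have WW := unitarymxP hW.
pose e := \row_i (lam i - t)%:C : 'rV[C]_n.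
have -> : W *m diag_mx (\row_i (lam i)%:C) *m W^t* - t%:C%:M =
    (W^t*)^t* *m diag_mx e *m W^t*.
  have -> : diag_mx e = diag_mx (\row_i (lam i)%:C) - t%:C%:M.
    rewrite -diag_const_mx -linearB; congr diag_mx.
    by apply/rowP => i; rewrite !mxE rmorphB.
  rewrite trmxCK mulmxBr mulmxBl mul_mx_scalar -scalemxAl WW scalemx1.
  by [].
split=> [|u].
  rewrite !adjmxM !trmxCK mulmxA tr_diag_mx map_diag_mx; congr (_ *m diag_mx _ *m _).
  by apply/rowP => i; rewrite !mxE; exact: conjc_real.
rewrite qform_diag trmxCK.
have -> : sqnorm u = sqnorm (u *m W).
  by rewrite /sqnorm adjmxM mulmxA mulmxtVK.
rewrite sqnormE big_ord1 mulr_sumr; apply: ler_sum => i _.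
rewrite ler_wpM2r ?exprn_ge0 // mxE lecR lerBrDl; exact: le_lam.
Qed.

End OrbitBounds.

(** * Extending the embedding by one block of equal eigenvalues *)

Section Extension.
Context {R : realType} (d m : nat) (t : R).
Local Notation C := R[i].
Implicit Types (A : 'M[C]_d) (Z : 'M[C]_(m, d)) (E : 'M[C]_(d + m)).

(** [extend] adjoins to A a block of m eigenvalues t, with coordinates Z; the
functions from [corner] to [get_base] undo it. *)
Definition polar_factor A Z : 'M[C]_d := sqrtmx (A - t%:C%:M - Z^t* *m Z).

Definition frame A Z : 'M[C]_(d + m, d) := col_mx (polar_factor A Z) Z.

Definition extend A Z : 'M[C]_(d + m) := t%:C%:M + frame A Z *m (frame A Z)^t*.

Definition corner E : 'M[C]_d := ulsubmx E - t%:C%:M.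

Definition get_polar E : 'M[C]_d := sqrtmx (corner E).

Definition get_coord E : 'M[C]_(m, d) := dlsubmx E *m invmx (get_polar E).

Definition get_base E : 'M[C]_d :=
  t%:C%:M + (corner E + (get_coord E)^t* *m get_coord E).

End Extension.

Section Step.
Context {R : realType} {V : normedModType R} (U : set V).
Hypothesis oU : open U.
Local Notation C := R[i].
Local Notation smooth M := (forall k, entrywise (@Ck_on R V R k U) M).

(** The pullback by f of the Kostant-Kirillov-Souriau form is the constant form
theta.  The generator X of the velocity is kept explicit, since the next step
of the construction builds its own generator from it. *)
Definition symplectic_for n (f : V -> 'M[C]_n) (theta : V -> V -> R) : Prop :=
  forall z v, U z -> exists X : 'M[C]_n,
    [/\ X^t* = X, adfield X (f z) = mxdiff f z v &
        forall w, - complex.Re (\tr (X *m mxdiff f z w)) = theta v w].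

(** phi factors through f by a map that is continuous on the range of f.  The
continuity is stated along an arbitrary parametrization A of points of the
range, so that it composes with the block extractions of [extend]. *)
Definition recoverable n (f : V -> 'M[C]_n) (phi : V -> C) : Prop :=
  exists2 g : 'M[C]_n -> C, (forall z, U z -> g (f z) = phi z) &
    forall (T : topologicalType) (D : set T) (A : T -> 'M[C]_n),
      (forall t, D t -> exists2 z, U z & A t = f z) ->
      entrywise (@continuous_in R T D) A ->
      complexwise (@continuous_in R T D) (fun t => g (A t)).

Variables (d m : nat) (lam : 'I_d -> R) (t c : R).
Variables (f : V -> 'M[C]_d) (Z : V -> 'M[C]_(m, d)).
Hypothesis lam_gap : forall i, t + c <= lam i.
Hypothesis Z_small : forall z, U z -> resqnorm (Z z) < c.
Hypothesis Z_smooth : smooth Z.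
Hypothesis f_smooth : smooth f.
Hypothesis f_orbit : forall z, U z -> coadjoint_orbit lam (f z).

Let B z := f z - t%:C%:M.
Let S z := polar_factor t (f z) (Z z).
Let F z := frame t (f z) (Z z).
Let E z := extend t (f z) (Z z).

Let posB z : U z -> posdef (B z).
Proof.
move=> Uz; have [hB leB] := coadjoint_orbit_coercive (f_orbit Uz) lam_gap.
apply: (coercive_posdef hB _ leB); rewrite ltcR.
exact: le_lt_trans (resqnorm_ge0 _) (Z_small Uz).
Qed.

Let posBZ z : U z -> posdef (B z - (Z z)^t* *m Z z).
Proof.
move=> Uz; have [hB leB] := coadjoint_orbit_coercive (f_orbit Uz) lam_gap.
apply: (@coercive_posdef _ _ _ (c%:C - sqnorm (Z z))).
- by rewrite adjmxB hB adjmxM trmxCK.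
- by rewrite sqnorm_real subr_gt0 ltcR Z_small.
move=> u; rewrite qformB mulrBl lerB // qform_gram.
by rewrite [leRHS]mulrC CauchySchwarz_mx.
Qed.

Let posS z : U z -> posdef (S z).
Proof. by move=> Uz; apply/sqrtmx_posdef/posBZ. Qed.

Let gramF z : U z -> (F z)^t* *m F z = B z.
Proof.
move=> Uz; rewrite /F /frame col_gram (posdef_adj (posS Uz)) sqrtmxK ?subrK //.
exact: posBZ.
Qed.

Let B_smooth : smooth B.
Proof.
move=> k; have FA := Ck_on_algebra k oU.
apply: (entrywise_add FA) (f_smooth k) _; exact: (entrywise_cst FA).
Qed.

Let S_smooth : smooth S.
Proof.
apply: sqrtmx_smooth oU posBZ _ => k; have FA := Ck_on_algebra k oU.
apply: (entrywise_add FA) (B_smooth k) _; apply: (entrywise_opp FA).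
apply: (entrywise_mul FA) _ (Z_smooth k).
exact: (entrywise_adj FA) (Z_smooth k).
Qed.

Let F_smooth : smooth F.
Proof.
by move=> k; apply: (entrywise_col (Ck_on_algebra k oU)) (S_smooth k) (Z_smooth k).
Qed.

Lemma extend_smooth : smooth (fun z => extend t (f z) (Z z)).
Proof.
move=> k; have FA := Ck_on_algebra k oU.
apply: (entrywise_add FA); first exact: (entrywise_cst FA).
apply: (entrywise_mul FA) (F_smooth k) _.
exact: (entrywise_adj FA) (F_smooth k).
Qed.

Lemma extend_orbit (lam' : 'I_(d + m) -> R) :
    (forall i, lam' (lshift m i) = lam i) -> (forall j, lam' (rshift d j) = t) ->
  forall z, U z -> coadjoint_orbit lam' (extend t (f z) (Z z)).
Proof.
move=> lamL lamR z Uz; have [W hW eW] := f_orbit Uz.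
have [Q hQ eQ] := frame_unitary (posdef_unit (posS Uz)) (posB Uz) (gramF Uz).
pose W' : 'M[C]_(d + m) := block_mx W 0 0 1%:M.
have W't : W'^t* = block_mx (W^t*) 0 0 1%:M.
  by rewrite /W' tr_block_mx map_block_mx adjmx1 !adjmx0.
have hW' : W' \is unitarymx.
  apply/unitarymxP; rewrite W't mulmx_block !mulmx0 !mul0mx !addr0 add0r mulmx1.
  by rewrite (unitarymxP hW) -scalar_mx_block.
exists (Q *m W'); first exact: mul_unitarymx.
have -> : diag_mx (\row_i (lam' i)%:C) =
    block_mx (diag_mx (\row_i (lam i)%:C)) 0 0 t%:C%:M :> 'M[C]_(d + m).
  rewrite -diag_const_mx -diag_mx_row; congr diag_mx.
  apply/rowP => k; rewrite -(splitK k); case: (fintype.split k) => j /=.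
    by rewrite row_mxEl !mxE lamL.
  by rewrite row_mxEr !mxE lamR.
rewrite adjmxM W't !mulmxA -[Q *m W' *m _]mulmxA -[Q *m _ *m block_mx _ _ _ _]mulmxA.
have -> : W' *m block_mx (diag_mx (\row_i (lam i)%:C)) 0 0 t%:C%:M *m
    block_mx (W^t*) 0 0 1%:M = block_mx (B z) 0 0 0 + t%:C%:M :> 'M[C]_(d + m).
  rewrite !mulmx_block !(mulmx0, mul0mx, addr0, add0r, mulmx1, mul1mx) -eW.
  by rewrite [t%:C%:M as X in _ = _ + X]scalar_mx_block add_block_mx subrK !addr0 add0r.
rewrite mulmxDr mulmxDl -eQ addrC mul_mx_scalar -scalemxAl (unitarymxP hQ).
by rewrite scalemx1.
Qed.

Lemma extend_symplectic (theta beta : V -> V -> R) :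
    symplectic_for f theta ->
    (forall z v w, U z ->
      complex.Im (\tr ((mxdiff Z z v)^t* *m mxdiff Z z w)) = pi * beta v w) ->
  symplectic_for (fun z => extend t (f z) (Z z)) (fun v w => theta v w + beta v w).
Proof.
move=> sf betaE z v Uz; have [Y [hY eY fY]] := sf z v Uz.
have FA := diff_at_algebra oU Uz.
have dF : entrywise (diff_at z) F := Ck_on_diff_at Uz (F_smooth 1).
have dS : entrywise (diff_at z) S := Ck_on_diff_at Uz (S_smooth 1).
have dFt := entrywise_adj FA dF.
have df w : mxdiff f z w = (mxdiff F z w)^t* *m F z + (F z)^t* *m mxdiff F z w.
  rewrite -(mxdiff_adj w dF) -(mxdiff_mul w dFt dF).
  transitivity (mxdiff B z w).
    rewrite /B mxdiff_add ?mxdiff_cst ?addr0 //; last exact: (entrywise_cst FA).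
    exact: Ck_on_diff_at Uz (f_smooth 1).
  apply: (mxdiff_ext w oU Uz) => [y Uy|]; first by rewrite gramF.
  exact: Ck_on_diff_at Uz (B_smooth 1).
have de w : mxdiff E z w = mxdiff F z w *m (F z)^t* + F z *m (mxdiff F z w)^t*.
  rewrite -(mxdiff_adj w dF) -(mxdiff_mul w dF dFt) /E /extend -/(F z).
  rewrite mxdiff_add ?mxdiff_cst ?add0r //.
    exact: (entrywise_cst FA).
  exact: (entrywise_mul FA).
have uB : (F z)^t* *m F z \in unitmx by rewrite gramF //; exact/posdef_unit/posB.
have eYF : adfield Y ((F z)^t* *m F z) =
    (mxdiff F z v)^t* *m F z + (F z)^t* *m mxdiff F z v.
  by rewrite -df -eY gramF // /B -raddfN /= adfield_shift.
have [X [hX eX vX]] := adfield_frame uB hY eYF.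
exists X; split=> // [|w]; first by rewrite /E /extend -/(F z) addrC adfield_shift eX de.
rewrite de vX -df -fY addrC; congr (_ + _).
have hS w' : (mxdiff S z w')^t* = mxdiff S z w'.
  rewrite -mxdiff_adj //; apply: (mxdiff_ext w' oU Uz) => [y Uy|].
    by rewrite (posdef_adj (posS Uy)).
  exact: (entrywise_adj FA).
rewrite /F /frame !mxdiff_col adjmx_col mul_row_col mxtraceD raddfD /= hS.
rewrite (tr_hermitian_im (hS v) (hS w)) add0r betaE //.
by rewrite mulKf // gt_eqF // pi_gt0.
Qed.

Let extendE z : U z ->
  E z = t%:C%:M + block_mx (S z *m S z) (S z *m (Z z)^t*)
                               (Z z *m S z) (Z z *m (Z z)^t*).
Proof.
move=> Uz; rewrite /E /extend /frame -/(S z) adjmx_col mul_col_row (posdef_adj (posS Uz)).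
by [].
Qed.

Let cornerE z : U z -> corner t (E z) = S z *m S z.
Proof.
move=> Uz; rewrite /corner extendE // scalar_mx_block add_block_mx block_mxKul.
by rewrite addrC addKr.
Qed.

Let get_polarE z : U z -> get_polar t (E z) = S z.
Proof.
move=> Uz; have pE : posdef (corner t (E z)) by rewrite cornerE // sqrtmxK; exact: posBZ.
apply: (posdef_sqr_inj (sqrtmx_posdef pE) (posS Uz)).
by rewrite (sqrtmxK pE) cornerE.
Qed.

Let get_coordE z : U z -> get_coord t (E z) = Z z.
Proof.
move=> Uz; rewrite /get_coord get_polarE // extendE // scalar_mx_block add_block_mx.
by rewrite block_mxKdl add0r mulmxK //; exact/posdef_unit/posS.
Qed.

Let get_baseE z : U z -> get_base t (E z) = f z.
Proof.
move=> Uz; rewrite /get_base get_coordE // cornerE // sqrtmxK ?subrK; last exact: posBZ.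
by rewrite /B addrC subrK.
Qed.

Section Inverse.
Context (T : topologicalType) (D : set T) (A : T -> 'M[C]_(d + m)).
Hypothesis A_ext : forall t, D t -> exists2 z, U z & A t = E z.
Hypothesis A_cont : entrywise (@continuous_in R T D) A.
Let FA := continuous_in_algebra R D.

Fact corner_cont : entrywise (@continuous_in R T D) (fun x => corner t (A x)).
Proof.
apply: (entrywise_add FA); last exact: (entrywise_cst FA).
apply: (entrywise_ext FA) (entrywise_sub FA (lshift m) (lshift m) A_cont).
by move=> x _; apply/matrixP => i j; rewrite !mxE.
Qed.

Fact get_polar_cont : entrywise (@continuous_in R T D) (fun x => get_polar t (A x)).
Proof.
apply: sqrtmx_continuous_in corner_cont => x /A_ext [z Uz ->].
by rewrite cornerE // sqrtmxK; exact: posBZ.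
Qed.

Fact get_coord_cont : entrywise (@continuous_in R T D) (fun x => get_coord t (A x)).
Proof.
apply: (entrywise_mul FA).
  apply: (entrywise_ext FA) (entrywise_sub FA (@rshift d m) (lshift m) A_cont).
  by move=> x _; apply/matrixP => i j; rewrite !mxE.
apply: (entrywise_inv FA) get_polar_cont => x /A_ext [z Uz ->].
by rewrite get_polarE //; exact/posdef_unit/posS.
Qed.

Fact get_base_cont : entrywise (@continuous_in R T D) (fun x => get_base t (A x)).
Proof.
apply: (entrywise_add FA); first exact: (entrywise_cst FA).
apply: (entrywise_add FA) corner_cont _.
exact: (entrywise_mul FA (entrywise_adj FA get_coord_cont) get_coord_cont).
Qed.
End Inverse.

Lemma extend_recover_base phi : recoverable f phi ->
  recoverable (fun z => extend t (f z) (Z z)) phi.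
Proof.
move=> [g gf gc]; exists (fun A => g (get_base t A)) => [z Uz|T D A AE Ac].
  by rewrite get_baseE // gf.
apply: gc; last exact: get_base_cont.
by move=> x /AE [z Uz ->]; exists z; rewrite ?get_baseE.
Qed.

Lemma extend_recover_new i j :
  recoverable (fun z => extend t (f z) (Z z)) (fun z => Z z i j).
Proof.
exists (fun A => get_coord t A i j) => [z Uz|T D A AE Ac]; first by rewrite get_coordE.
exact: get_coord_cont.
Qed.

End Step.

(** * The tower of all blocks *)

Section Tower.
Context {R : realType} {V : normedModType R} (U : set V).
Hypothesis oU : open U.
Local Notation C := R[i].
Variables (n : nat) (mu : nat -> R) (a : R) (W : nat -> nat -> V -> C).
Hypothesis mu_mono : forall i j, (i <= j < n)%N -> mu j <= mu i.
Hypothesis mu_gap : forall i j, (i < n)%N -> (j < n)%N -> mu j < mu i ->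
  a <= mu i - mu j.
Hypothesis W_smooth : forall p q k, complexwise (@Ck_on R V R k U) (W p q).
Hypothesis W_linear : forall p q z v, U z -> cdiff (W p q) z v = W p q v.

(** W p q is the coordinate attached to the pair of eigenvalues mu p > mu q.  The
block added after the first d eigenvalues has its rows indexed by the new
eigenvalues. *)
Definition coord_block d m (z : V) : 'M[C]_(m, d) :=
  \matrix_(i < m, j < d) W j (d + i) z.

Hypothesis W_small : forall d m z, (d + m <= n)%N ->
  (forall i j, (i < d)%N -> (j < m)%N -> mu (d + j) < mu i) ->
  U z -> resqnorm (coord_block d m z) < a.

Definition coord_form p q (v w : V) : R :=
  pi^-1 * complex.Im ((W p q v)^* * W p q w).

Definition partial_form d (v w : V) : R :=
  \sum_(p < d) \sum_(q < d | mu q < mu p) coord_form p q v w.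

(** The part of the embedding that involves the first d eigenvalues only; it
depends only on the coordinates W p q with p, q < d. *)
Definition tower_stage d : Prop := exists f : V -> 'M[C]_d,
  [/\ forall k, entrywise (@Ck_on R V R k U) f,
      forall z, U z -> coadjoint_orbit (fun i : 'I_d => mu i) (f z),
      symplectic_for U f (partial_form d) &
      forall p q, (p < d)%N -> (q < d)%N -> mu q < mu p ->
        recoverable U f (W p q)].

Lemma tower_stage0 : tower_stage 0.
Proof.
have M0 (A B : 'M[C]_0) : A = B by rewrite [A]flatmx0 [B]flatmx0.
exists (fun=> 0); split.
- by move=> k [].
- move=> z _; exists 1%:M; last exact: M0.
  by apply/unitarymxP; exact: M0.
- move=> z v _; exists 0; split; [exact: M0|exact: M0|move=> w].
  by rewrite /mxtrace /partial_form !big_ord0 oppr0.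
- by [].
Qed.

Lemma tower_stage_extend d m : (d + m <= n)%N ->
    (forall i j, (i < d)%N -> (j < m)%N -> mu (d + j) < mu i) ->
    (forall j j', (j < m)%N -> (j' < m)%N -> mu (d + j) = mu (d + j')) ->
  tower_stage d -> tower_stage (d + m).
Proof.
move=> dmn above const [f [f_sm f_orb f_symp f_rec]].
have [->|m0] := posnP m; first by rewrite addn0; exists f.
pose t := mu (d + 0); pose Z := coord_block d m.
have tE j : (j < m)%N -> mu (d + j) = t by move=> jm; exact: const.
have gap (i : 'I_d) : t + a <= mu i.
  rewrite addrC -lerBrDr mu_gap //; last exact: above.
    exact: leq_trans (ltn_ord i) (leq_trans (leq_addr _ _) dmn).
  by rewrite (leq_trans _ dmn) // ltn_add2l.
have Z_small z : U z -> resqnorm (Z z) < a by exact: W_small.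
have Z_sm k : entrywise (@Ck_on R V R k U) Z.
  move=> i j; apply: (complexwise_ext (Ck_on_algebra k oU)) (W_smooth j (d + i) k).
  by move=> z _; rewrite mxE.
have dZ z v : U z -> mxdiff Z z v = Z v.
  move=> Uz; apply/matrixP => i j; rewrite !mxE -(W_linear _ _ _ Uz).
  by congr (cdiff _ z v); apply/funext => y; rewrite mxE.
pose beta v w := \sum_(p < d) \sum_(q < m) coord_form p (d + q) v w.
have betaE z v w : U z ->
    complex.Im (\tr ((mxdiff Z z v)^t* *m mxdiff Z z w)) = pi * beta v w.
  move=> Uz; rewrite !dZ // /mxtrace raddf_sum /= /beta mulr_sumr.
  apply: eq_bigr => p _; rewrite mxE raddf_sum /= mulr_sumr.
  apply: eq_bigr => q _; rewrite !mxE /coord_form mulVKf //.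
  by rewrite gt_eqF // pi_gt0.
exists (fun z => extend t (f z) (Z z)); split.
- exact: (extend_smooth oU gap Z_small Z_sm f_sm f_orb).
- apply: (extend_orbit gap Z_small f_orb) => // j /=.
  exact: tE.
- have := extend_symplectic oU gap Z_small Z_sm f_sm f_orb f_symp betaE.
  congr symplectic_for; apply/funext => v; apply/funext => w.
  rewrite /partial_form big_split_ord /= [X in _ = _ + X]big1 ?addr0.
    rewrite /beta -big_split; apply: eq_bigr => p _ /=.
    rewrite [in RHS](big_split_ord); congr (_ + _).
    by apply: eq_bigl => q; rewrite above.
  move=> p _; rewrite big_pred0 // => q; rewrite tE //.
  rewrite -(splitK q); case: (fintype.split q) => j /=.
    by apply/negbTE; rewrite -leNgt -(tE _ (ltn_ord p)) ltW // above.
  by rewrite tE // ltxx.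
- move=> p q pdm qdm lt_qp.
  have [pd|dp] := ltnP p d; last first.
    have pE : mu p = t by rewrite -(subnKC dp) tE // ltn_subLR.
    have [qd|dq] := ltnP q d.
      have := above q (p - d)%N qd; rewrite ltn_subLR // subnKC // => /(_ pdm).
      by rewrite ltNge (ltW lt_qp).
    by move: lt_qp; rewrite pE -(subnKC dq) tE ?ltxx // ltn_subLR.
  have [qd|dq] := ltnP q d.
    apply: (extend_recover_base gap Z_small f_orb).
    exact: f_rec.
  have qm : (q - d < m)%N by rewrite ltn_subLR.
  have := extend_recover_new gap Z_small f_orb (Ordinal qm) (Ordinal pd).
  congr recoverable; apply/funext => z; rewrite mxE /=.
  by rewrite subnKC.
Qed.

(** The hypothesis says that no block of equal eigenvalues straddles d.  The
induction removes the last block, which starts at the first index whose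
eigenvalue is that of d - 1. *)
Lemma tower_stageP d : (d <= n)%N ->
  (forall i j, (i < d)%N -> (d <= j < n)%N -> mu j < mu i) -> tower_stage d.
Proof.
elim/ltn_ind: d => d IHd dn cut.
have [->|d0] := posnP d; first exact: tower_stage0.
have ex : exists i, mu i <= mu d.-1 by exists d.-1.
case: (ex_minnP ex) => d' le_d' min_d'.
have d'd : (d' <= d.-1)%N by exact: min_d'.
have lt_d' : (d' < d)%N by rewrite -(prednK d0) ltnS.
have above i : (i < d')%N -> mu d.-1 < mu i.
  move=> lt_i; rewrite ltNge; apply/negP => /min_d'.
  by rewrite leqNgt lt_i.
have eqt i : (d' <= i < d)%N -> mu i = mu d.-1.
  move=> /andP[le_i lt_i]; apply/eqP; rewrite eq_le; apply/andP; split.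
    by rewrite (le_trans _ le_d') // mu_mono // le_i (leq_trans lt_i).
  by apply: mu_mono; apply/andP; split; rewrite ?prednK // -ltnS prednK.
have block i : (d' <= i < n)%N -> mu i <= mu d.-1.
  by move=> d'i; apply: le_trans le_d'; exact: mu_mono.
rewrite -(subnKC (ltnW lt_d')); apply: tower_stage_extend.
- by rewrite subnKC // ltnW.
- move=> i j id' jm; apply: le_lt_trans (above i id').
  rewrite block // leq_addr /= (leq_trans _ dn) //.
  by rewrite -ltn_subRL.
- move=> j j'; rewrite !ltn_subRL => jm j'm.
  by rewrite !eqt // leq_addr.
apply: IHd => // [|i j id' /block]; first exact: leq_trans (ltnW lt_d') dn.
by move/le_lt_trans; apply; exact: above.
Qed.

End Tower.

(** * Real coordinates on the ball and on the space of matrices *)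

Section LinearMaps.
Context {R : realType} {V : normedModType R}.
Local Notation C := R[i].

Lemma Ck_on_linear_fun (W : normedModType R) (l : V -> W) k U :
  linear l -> continuous l -> Ck_on k U l.
Proof.
move=> lin_l cl; pose L := GRing.isLinear.Build _ _ _ _ _ lin_l.
pose lL : {linear V -> W} := HB.pack l L.
exact: (@Ck_on_linear R V W k U lL).
Qed.

Lemma diff_linear_fun (W : normedModType R) (l : V -> W) x v :
  linear l -> continuous l -> 'd l x v = l v.
Proof.
move=> lin_l cl; pose L := GRing.isLinear.Build _ _ _ _ _ lin_l.
pose lL : {linear V -> W} := HB.pack l L.
exact: (congr1 (@^~ v) (@diff_lin _ _ _ lL x cl)).
Qed.

Lemma diff_comp_linear (W : normedModType R) (f : V -> W) (l : W -> R) x v :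
  linear l -> continuous l -> differentiable f x ->
  'd (fun y => l (f y)) x v = l ('d f x v).
Proof.
move=> lin_l cl df; pose L := GRing.isLinear.Build _ _ _ _ _ lin_l.
pose lL : {linear W -> R} := HB.pack l L.
have dl := @linear_differentiable _ _ _ lL (f x) cl.
apply: etrans (congr1 (@^~ v) (diff_comp df dl)) _.
exact: (congr1 (@^~ _) (@diff_lin _ _ _ lL (f x) cl)).
Qed.
End LinearMaps.

Section RealImaginaryParts.
Context {R : realType} {V : normedModType R}.
Local Notation C := R[i].

Lemma Ck_on_sum (W : normedModType R) k (U : set V) I (r : seq I) (F : I -> V -> W) :
  open U -> (forall i, Ck_on k U (F i)) -> Ck_on k U (fun x => \sum_(i <- r) F i x).
Proof.
move=> oU CF; elim: r => [|i r IHr].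
  by apply: Ck_on_ext (Ck_on_cst k U 0) => // x _; rewrite big_nil.
by apply: Ck_on_ext (Ck_on_add oU (CF i) IHr) => // x _; rewrite big_cons.
Qed.

Lemma reim_sum n (A : 'M[C]_n) :
  reim A = \sum_i \sum_j (complex.Re (A i j) *: (delta_mx i j : 'M[R]_n, 0 : 'M[R]_n)
                        + complex.Im (A i j) *: (0 : 'M[R]_n, delta_mx i j : 'M[R]_n)).
Proof.
apply: injective_projections; rewrite !raddf_sum /= [LHS]matrix_sum_delta;
  apply: eq_bigr => i _; rewrite raddf_sum; apply: eq_bigr => j _ /=;
  by rewrite mxE scaler0 ?addr0 ?add0r.
Qed.

Lemma Ck_on_reim k (U : set V) n (f : V -> 'M[C]_n) : open U ->
  entrywise (@Ck_on R V R k U) f -> Ck_on k U (reim (n:=n) \o f).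
Proof.
move=> oU Cf.
pose F i j x := complex.Re (f x i j) *: (delta_mx i j : 'M[R]_n, 0 : 'M[R]_n)
  + complex.Im (f x i j) *: (0 : 'M[R]_n, delta_mx i j : 'M[R]_n).
apply: (@Ck_on_ext _ _ _ _ _ (fun x => \sum_i \sum_j F i j x)) => //.
  by move=> x _; rewrite /= reim_sum.
apply: Ck_on_sum => // i; apply: Ck_on_sum => // j; have [Cr Ci] := Cf i j.
by apply: Ck_on_add => //; exact: Ck_on_scalel.
Qed.

Lemma dmxE n (f : V -> 'M[C]_n) z v : differentiable (reim (n:=n) \o f) z ->
  dmx f z v = mxdiff f z v.
Proof.
move=> df; have key (l : 'M[R]_n * 'M[R]_n -> R) (phi : V -> R) :
    linear l -> continuous l -> (forall y, phi y = l (reim (f y))) ->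
    l ('d (reim (n:=n) \o f) z v) = ddiff phi z v.
  move=> lin_l cl phiE; apply: etrans (esym (diff_comp_linear v lin_l cl df)) _.
  by rewrite (_ : phi = fun y => l ((reim (n:=n) \o f) y)) //; apply/funext.
apply/matrixP => i j; rewrite !mxE; apply: (f_equal2 (@Complex R)).
  apply: (key (fun P => P.1 i j)) => [b P Q|P|y]; last by rewrite mxE.
    by rewrite /= !mxE.
  by apply: (continuous_comp (f := fst) (g := fun M : 'M[R]_n => M i j));
    [exact: cvg_fst|exact: coord_continuous].
apply: (key (fun P => P.2 i j)) => [b P Q|P|y]; last by rewrite mxE.
  by rewrite /= !mxE.
by apply: (continuous_comp (f := snd) (g := fun M : 'M[R]_n => M i j));
    [exact: cvg_snd|exact: coord_continuous].
Qed.
End RealImaginaryParts.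

Section Ball.
Context {R : realType} (N : nat).
Local Notation V := ('rV[R]_N * 'rV[R]_N)%type.

Lemma coord1_linear (k : 'I_N) : linear (fun z : V => z.1 0 k).
Proof. by move=> b u v; rewrite /= !mxE. Qed.

Lemma coord2_linear (k : 'I_N) : linear (fun z : V => z.2 0 k).
Proof. by move=> b u v; rewrite /= !mxE. Qed.

Lemma coord1_continuous (k : 'I_N) : continuous (fun z : V => z.1 0 k).
Proof.
move=> z; apply: (continuous_comp (f := fst) (g := fun M : 'rV[R]_N => M 0 k));
  [exact: cvg_fst|exact: coord_continuous].
Qed.

Lemma coord2_continuous (k : 'I_N) : continuous (fun z : V => z.2 0 k).
Proof.
move=> z; apply: (continuous_comp (f := snd) (g := fun M : 'rV[R]_N => M 0 k));
  [exact: cvg_snd|exact: coord_continuous].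
Qed.

Lemma open_ball_sympl (a : R) : open (ball_sympl a : set V).
Proof.
have FA := Ck_on_algebra 0 (@openT V).
have cf : continuous (fun z : V => pi * \sum_(j < N) (z.1 0 j ^+ 2 + z.2 0 j ^+ 2) : R).
  move=> z; suff C0 : Ck_on 0 setT
      (fun z : V => pi * \sum_(j < N) (z.1 0 j ^+ 2 + z.2 0 j ^+ 2) : R) by exact: C0.
  apply: (fa_mul FA); first exact: (fa_cst FA).
  apply: Ck_on_sum => [|j]; first exact: openT.
  have c1 := Ck_on_linear_fun 0 setT (coord1_linear j) (@coord1_continuous j).
  have c2 := Ck_on_linear_fun 0 setT (coord2_linear j) (@coord2_continuous j).
  exact: (fa_add FA) (fa_mul FA c1 c1) (fa_mul FA c2 c2).
have := @open_comp _ _ _ [set x : R | x < a] (in1W cf) (@open_lt R a).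
by [].
Qed.

End Ball.

Lemma continuous_continuous_in (R : realType) (T : topologicalType) (D : set T)
    (f : T -> R) : continuous f -> continuous_in D f.
Proof.
move=> cf x _; apply: cvg_trans (cf x); apply: cvg_app; exact: cvg_within.
Qed.

Lemma cvg_row (R : realType) (T : Type) (F : set_system T) {FF : Filter F}
    (N : nat) (x : 'I_N -> T -> R) (l : 'I_N -> R) :
  (forall k, x k t @[t --> F] --> l k) ->
  (\row_k x k t) @[t --> F] --> \row_k l k.
Proof.
move=> cx.
have rowE (y : 'I_N -> R) : \row_k y k = \sum_k y k *: delta_mx 0 k.
  by rewrite [LHS]row_sum_delta; apply: eq_bigr => k _; rewrite mxE.
rewrite rowE (_ : (fun t => _) = fun t => \sum_k x k t *: delta_mx 0 k); last first.
  by apply/funext => t; exact: rowE.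
elim: (index_enum _) => [|k r IHr].
  rewrite big_nil (_ : (fun t => _) = fun=> 0); first exact: cvg_cst.
  by apply/funext => t; rewrite big_nil.
rewrite big_cons.
rewrite (_ : (fun t => _) =
    fun t => x k t *: delta_mx 0 k + \sum_(j <- r) x j t *: delta_mx 0 j).
  by apply: (cvgD _ IHr); apply: cvgZr_tmp; exact: cx.
by apply/funext => t; rewrite big_cons.
Qed.

(** * The embedding of the ball *)

Section BallEmbedding.
Context {R : realType} (n : nat) (lam : 'I_n -> R) (a : R).
Local Notation C := R[i].
Local Notation N := (orbit_hdim lam).
Local Notation V := ('rV[R]_N * 'rV[R]_N)%type.
Local Notation U := (@ball_sympl R N a).
Hypothesis lam_mono : forall i j : 'I_n, (i <= j)%N -> lam j <= lam i.
Hypothesis lam_gap : forall i j : 'I_n, lam j < lam i -> a <= lam i - lam j.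

(** The coordinates of the ball are indexed by an enumeration of the pairs of
distinct eigenvalues; [root_index] inverts it. *)
Definition root_pair (k : 'I_N) : 'I_n * 'I_n :=
  enum_val (A := [pred p : 'I_n * 'I_n | lam p.2 < lam p.1]) k.

Definition root_index (p q : nat) : option 'I_N :=
  [pick k | ((root_pair k).1 == p :> nat) && ((root_pair k).2 == q :> nat)].

(** The factor sqrt pi turns the normalized form (1 / pi) Im (dW^* dW') of the
construction into the standard one, and |W|^2 into pi |z|^2. *)
Definition root_coord (p q : nat) (z : V) : C :=
  if root_index p q is Some k then Num.sqrt pi * z.1 0 k +i* (Num.sqrt pi * z.2 0 k)
  else 0.

Definition spectrum_fun (i : nat) : R := oapp lam 0 (insub i).

Lemma spectrum_funE (i : 'I_n) : spectrum_fun i = lam i.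
Proof. by rewrite /spectrum_fun valK. Qed.

Lemma spectrum_fun_ord i (i_n : (i < n)%N) : spectrum_fun i = lam (Ordinal i_n).
Proof. exact: (spectrum_funE (Ordinal i_n)). Qed.

Lemma root_pair_lt k : lam (root_pair k).2 < lam (root_pair k).1.
Proof. exact: (enum_valP (A := [pred p : 'I_n * 'I_n | lam p.2 < lam p.1]) k). Qed.

Lemma root_indexK k : root_index (root_pair k).1 (root_pair k).2 = Some k.
Proof.
rewrite /root_index; case: pickP => [k' /andP[/eqP e1 /eqP e2]|/(_ k)]; last first.
  by rewrite !eqxx.
congr Some; apply: enum_val_inj; rewrite -/(root_pair k) -/(root_pair k').
by apply: injective_projections; apply: val_inj.
Qed.

Lemma root_indexP p q k : root_index p q = Some k ->
  ((root_pair k).1 = p :> nat) /\ ((root_pair k).2 = q :> nat).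
Proof. by rewrite /root_index; case: pickP => // k' /andP[/eqP e1 /eqP e2] [<-]. Qed.

Lemma root_coord_smooth p q k : complexwise (@Ck_on R V R k U) (root_coord p q).
Proof.
have oU := @open_ball_sympl R N a; have FA := Ck_on_algebra k oU.
rewrite /root_coord; case: (root_index p q) => [j|]; last exact: (complexwise_cst FA).
split.
  apply: (fa_mul FA); first exact: (fa_cst FA).
  exact: Ck_on_linear_fun (coord1_linear j) (@coord1_continuous _ _ j).
apply: (fa_mul FA); first exact: (fa_cst FA).
exact: Ck_on_linear_fun (coord2_linear j) (@coord2_continuous _ _ j).
Qed.

Lemma root_coord_linear p q z v : U z ->
  cdiff (root_coord p q) z v = root_coord p q v.
Proof.
move=> Uz; rewrite /root_coord; case: (root_index p q) => [j|]; last exact: cdiff_cst.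
have lin (l : V -> R) : linear l -> continuous l ->
    ddiff (fun y => Num.sqrt pi * l y) z v = Num.sqrt pi * l v.
  move=> lin_l cl; have dl : diff_at z l by exact: (Ck_on_linear_fun 1 setT lin_l cl).1.
  have dc : diff_at z (fun=> Num.sqrt pi : R).
    exact: (fa_cst (diff_at_algebra (@open_ball_sympl R N a) Uz)).
  rewrite (ddiff_mul v dc dl).
  by rewrite ddiff_cst mul0r add0r /ddiff diff_linear_fun.
apply: (f_equal2 (@Complex R)).
  exact: lin (coord1_linear j) (@coord1_continuous _ _ j).
exact: lin (coord2_linear j) (@coord2_continuous _ _ j).
Qed.

(** Different entries of the block are different coordinates of z, so the sum of
their squares is part of the sum that defines the ball. *)
Lemma root_coord_small d m z : (d + m <= n)%N ->
  U z -> resqnorm (coord_block root_coord d m z) < a.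
Proof.
move=> dmn Uz; apply: le_lt_trans Uz.
pose g k := pi * (z.1 0 k ^+ 2 + z.2 0 k ^+ 2).
have g0 k : 0 <= g k by rewrite mulr_ge0 ?pi_ge0 // addr_ge0 // sqr_ge0.
rewrite mulr_sumr -/g /resqnorm.
have entry (i : 'I_m) (j : 'I_d) :
    complex.Re (coord_block root_coord d m z i j) ^+ 2 +
    complex.Im (coord_block root_coord d m z i j) ^+ 2 <=
    \sum_(k | root_index j (d + i) == Some k) g k.
  rewrite mxE /root_coord; case: (root_index j _) => [k|] /=; last first.
    by rewrite expr0n /= addr0 sumr_ge0.
  by rewrite (big_pred1 k) // !exprMn sqr_sqrtr ?pi_ge0 // -mulrDr.
apply: (@le_trans _ _ (\sum_(i < m) \sum_(j < d)
    \sum_(k | root_index j (d + i) == Some k) g k)).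
  by do 2![apply: ler_sum => ? _]; exact: entry.
rewrite pair_big /= (exchange_big_dep xpredT) //=.
apply: ler_sum => k _; rewrite sumr_const.
have : (#|[pred p : 'I_m * 'I_d | root_index p.2 (d + p.1) == Some k]| <= 1)%N.
  apply/card_le1_eqP => -[i j] [i' j'] /eqP/root_indexP[e1 e2] /eqP/root_indexP[e1' e2'].
  congr pair; last by apply: val_inj; rewrite /= -e1' e1.
  by apply: val_inj; apply: (@addnI d); rewrite -e2' e2.
by move=> le1; exact: (ler_wpMn2l (g0 k) le1).
Qed.

Lemma root_coord_form k v w :
  coord_form root_coord (root_pair k).1 (root_pair k).2 v w =
  v.1 0 k * w.2 0 k - v.2 0 k * w.1 0 k.
Proof.
rewrite /coord_form /root_coord root_indexK.
have gen (s p x y x' y' : R) : p != 0 -> s * s = p ->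
    p^-1 * complex.Im ((s * x +i* (s * y))^* * (s * x' +i* (s * y'))) = x * y' - y * x'.
  move=> p0 sp; have s0 : s != 0 by apply: contra p0 => /eqP s0; rewrite -sp s0 mul0r.
  by rewrite /= -sp; field.
by apply: gen; rewrite ?gt_eqF ?pi_gt0 // -expr2 sqr_sqrtr ?pi_ge0.
Qed.

Lemma root_form_std v w :
  partial_form spectrum_fun root_coord n v w = std_form v w.
Proof.
rewrite /partial_form /std_form pair_big_dep /=.
rewrite (eq_bigl (fun p => p \in [pred p : 'I_n * 'I_n | lam p.2 < lam p.1])).
  by rewrite big_enum_val; apply: eq_bigr => k _; rewrite -root_coord_form.
by move=> p; rewrite inE /= !spectrum_funE.
Qed.

(** The embedding is the last stage of the tower, and its inverse is assembled
from the coordinates, which are recovered one at a time. *)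
Lemma ball_embedding : exists f : V -> 'M[C]_n,
  symplectic_embedding a (coadjoint_orbit lam) (@kks R n) f.
Proof.
have oU := @open_ball_sympl R N a.
have mono i j : (i <= j < n)%N -> spectrum_fun j <= spectrum_fun i.
  move=> /andP[ij jn]; have ei := leq_ltn_trans ij jn.
  by rewrite (spectrum_fun_ord jn) (spectrum_fun_ord ei); exact: lam_mono.
have gap i j : (i < n)%N -> (j < n)%N -> spectrum_fun j < spectrum_fun i ->
    a <= spectrum_fun i - spectrum_fun j.
  by move=> ei jn; rewrite (spectrum_fun_ord jn) (spectrum_fun_ord ei); exact: lam_gap.
have small d m z : (d + m <= n)%N ->
    (forall i j, (i < d)%N -> (j < m)%N -> spectrum_fun (d + j) < spectrum_fun i) ->
    U z -> resqnorm (coord_block root_coord d m z) < a.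
  by move=> dmn _; exact: root_coord_small.
have [||f [f_sm f_orb f_symp f_rec]] :=
    tower_stageP oU mono gap root_coord_smooth root_coord_linear small (d := n).
- exact: leqnn.
- by move=> i j _ /andP[+ +]; rewrite leqNgt => /negbTE ->.
have orb z : U z -> coadjoint_orbit lam (f z).
  move=> /f_orb; congr coadjoint_orbit; apply/funext => i.
  exact: spectrum_funE.
have rec (k : 'I_N) : exists g : 'M[C]_n -> R * R,
    (forall z, U z -> g (f z) = (z.1 0 k, z.2 0 k)) /\
    forall (T : topologicalType) (D : set T) (A : T -> 'M[C]_n),
      (forall t, D t -> exists2 z, U z & A t = f z) ->
      entrywise (@continuous_in R T D) A ->
      continuous_in D (fun t => (g (A t)).1) /\ continuous_in D (fun t => (g (A t)).2).
  have lt_k : spectrum_fun (root_pair k).2 < spectrum_fun (root_pair k).1.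
    by rewrite !spectrum_funE; exact: root_pair_lt.
  have [g gf gc] := f_rec _ _ (ltn_ord (root_pair k).1) (ltn_ord (root_pair k).2) lt_k.
  have s0 : Num.sqrt pi != 0 :> R by rewrite gt_eqF // sqrtr_gt0 pi_gt0.
  exists (fun A => ((Num.sqrt pi)^-1 * complex.Re (g A),
                    (Num.sqrt pi)^-1 * complex.Im (g A))).
  split=> [z Uz|T D A AE Ac].
    by rewrite gf // /root_coord root_indexK /= !mulKf.
  have [cr ci] := gc T D A AE Ac; have FA := continuous_in_algebra R D.
  by split; apply: (fa_mul FA) => //; exact: (fa_cst FA).
have {rec} [G Gspec] := choice rec.
exists f; have reimK (A : 'M[C]_n) : of_reim (reim A) = A.
  by apply/matrixP => i j; rewrite !mxE; case: (A i j).
pose g (P : 'M[R]_n * 'M[R]_n) : V :=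
  (\row_k (G k (of_reim P)).1, \row_k (G k (of_reim P)).2).
have gK z : U z -> g (reim (f z)) = z.
  move=> Uz; rewrite /g reimK; apply: injective_projections; apply/rowP => k;
    by rewrite mxE (Gspec k).1.
have f_diff z : U z -> differentiable (reim (n:=n) \o f) z.
  by move=> Uz; exact: (Ck_on_reim oU (f_sm 1)).1.
split=> //.
- by move=> k; exact: Ck_on_reim.
- by move=> z w /set_mem Uz /set_mem Uw fzw; rewrite -(gK _ Uz) -(gK _ Uw) fzw.
- exists g => //.
  set D := _ @` _.
  have of_cont : entrywise (@continuous_in R ('M[R]_n * 'M[R]_n)%type D) (@of_reim R n).
    move=> i j.
    have reE : (fun P => complex.Re (of_reim P i j)) =
        fun P : 'M[R]_n * 'M[R]_n => P.1 i j.
      by apply/funext => P; rewrite mxE.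
    have imE : (fun P => complex.Im (of_reim P i j)) =
        fun P : 'M[R]_n * 'M[R]_n => P.2 i j.
      by apply/funext => P; rewrite mxE.
    split; apply: continuous_continuous_in; [rewrite reE|rewrite imE] => P.
      by apply: (continuous_comp (f := fst) (g := fun M : 'M[R]_n => M i j));
        [exact: cvg_fst|exact: coord_continuous].
    by apply: (continuous_comp (f := snd) (g := fun M : 'M[R]_n => M i j));
      [exact: cvg_snd|exact: coord_continuous].
  have DE P : D P -> exists2 z, U z & of_reim P = f z.
    by move=> [z Uz <-]; exists z; rewrite //= reimK.
  apply/subspace_continuousP => P DP; pose FF := within_filter D (nbhs_filter P).
  have cG1 : (\row_k (G k (of_reim Q)).1) @[Q --> within D (nbhs P)] --> (g P).1.
    apply: (cvg_row (FF := FF)) => k.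
    exact: ((Gspec k).2 _ D _ DE of_cont).1.
  have cG2 : (\row_k (G k (of_reim Q)).2) @[Q --> within D (nbhs P)] --> (g P).2.
    apply: (cvg_row (FF := FF)) => k.
    exact: ((Gspec k).2 _ D _ DE of_cont).2.
  exact: (cvg_pair (FF := FF) (FG := nbhs_filter _) (FH := nbhs_filter _) cG1 cG2).
- move=> z v w Uz; rewrite !(dmxE _ (f_diff z Uz)).
  have [X [hX eX vX]] := f_symp z v Uz; have [Y [hY eY _]] := f_symp z w Uz.
  rewrite -eX kksE; last by exists Y => //; exact/hermsymmxP.
    by rewrite vX root_form_std.
  exact/hermsymmxP.
Qed.

End BallEmbedding.

Lemma ord_step_nonincreasing (R : realType) (n : nat) (lam : 'I_n -> R) :
  (forall i j : 'I_n, nat_of_ord j = (nat_of_ord i).+1 -> lam j <= lam i) ->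
  forall i j : 'I_n, (i <= j)%N -> lam j <= lam i.
Proof.
move=> step i [j jn]; elim: j jn => [|j IHj] jn /= ij.
  by rewrite (_ : i = Ordinal jn) //; apply: val_inj => /=; apply/eqP; rewrite -leqn0.
have [ij'|ji] := leqP i j.
  exact: le_trans (step (Ordinal (ltnW jn)) (Ordinal jn) erefl) (IHj (ltnW jn) ij').
by rewrite (_ : i = Ordinal jn) //; apply: val_inj; apply/eqP; rewrite eqn_leq ij.
Qed.

Local Open Scope ereal_scope.

(* lam is indexed from 0: lambda_(i+1) is lam i. *)
Theorem theorem1p1 (R : realType) (n : nat) (lam : 'I_n -> R) (l s : nat)
    (hl : (1 <= l)%N) (hls : (l + s <= n)%N)
    (hlam : forall i j : 'I_n, nat_of_ord j = (nat_of_ord i).+1 ->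
       if ((l <= i.+1) && (j.+1 <= l + s))%N then lam i = lam j
       else (lam j < lam i)%R)
    (hneq : exists i j : 'I_n, lam i <> lam j) :
  \big[mine/+oo]_(p : 'I_n * 'I_n | (lam p.2 < lam p.1)%R)
     (lam p.1 - lam p.2)%:E
  <= gromov_width (orbit_hdim lam) (coadjoint_orbit lam) (@kks R n).
Proof.
have lam_mono : forall i j : 'I_n, (i <= j)%N -> (lam j <= lam i)%R.
  apply: ord_step_nonincreasing => i j /hlam; case: ifP => _; last exact: ltW.
  by move=> ->.
have [p0 lt_p0] : exists p : 'I_n * 'I_n, (lam p.2 < lam p.1)%R.
  have [i [j /eqP]] := hneq; rewrite neq_lt => /orP[lt_ij|lt_ji].
    by exists (j, i).
  by exists (i, j).
pose gap (p : 'I_n * 'I_n) : R := (lam p.1 - lam p.2)%R.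
have [p lt_p min_p] := @arg_minP _ _ _ p0
  (fun p : 'I_n * 'I_n => (lam p.2 < lam p.1)%R) gap lt_p0.
have gap0 : (0 < gap p)%R by rewrite subr_gt0.
have [f emb_f] := ball_embedding lam_mono (fun i j lt_ji => min_p (i, j) lt_ji).
apply: (@le_trans _ _ (gap p)%:E).
  exact: (bigmin_le_cond _ (fun p : 'I_n * 'I_n => (gap p)%:E) lt_p).
by apply: ereal_sup_ubound; exists (gap p) => //; split=> //; exists f.
Qed.
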